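(* Let $k>0$ and $f(t)=-kt$, and let $\mathbf{g}_f$ be the associated pseudo-Riemannian metric on $\mathbb{H}^2\times\mathbb{C}$ (defined in the context). Then any isometry $h:(\mathbb{H}^2\times\mathbb{C},\mathbf{g}_f)\to(\mathbb{H}^2\times\mathbb{C},\mathbf{g}_f)$ can be written in one of the forms $$h=P\circ e^{i\theta},\qquad h=P\circ e^{i\theta}\circ h_1,\qquad h=P\circ e^{i\theta}\circ h_2,\qquad h=P\circ e^{i\theta}\circ h_1\circ h_2$$ for some $P\in\mathbb{P}\mathrm{SL}(2,\mathbb{R})$ and $e^{i\theta}\in S^1$, where $h_1(z,w):=(-\bar z,w)$ and $h_2(z,w):=(z,\bar w)$.
   Context: Use coordinates $z=x+iy$, $y>0$, on the upper half-plane $\mathbb{H}^2$ and $w=u+iv$ on $\mathbb{C}$. For a smooth function $f:[0,+\infty)\to(-\infty,0]$ with $f(0)=0$, $f'<0$ and $\lim_{t\to+\infty}f(t)=-\infty$, the neutral-signature metric $\mathbf{g}_f$ is given in the basis $\{\partial_x,\partial_y,\partial_u,\partial_v\}$ by $$(\mathbf{g}_f)_{(z,w)}=\begin{pmatrix}\frac{1}{y^2}\big(1-f+3(u^2+v^2)y^3f'\big)&0&2f'vy^2&-2f'uy^2\\0&\frac{1}{y^2}\big(1-f+3(u^2+v^2)y^3f'\big)&2f'uy^2&2f'vy^2\\2f'vy^2&2f'uy^2&\frac43f'y^3&0\\-2f'uy^2&2f'vy^2&0&\frac43f'y^3\end{pmatrix},$$ with $f,f'$ evaluated at $y^3(u^2+v^2)$.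 A matrix $P=\begin{pmatrix}a&b\\c&d\end{pmatrix}\in\mathrm{SL}(2,\mathbb{R})$ acts by $P\cdot(z,w)=\big(\frac{az+b}{cz+d},(cz+d)^3w\big)$, and $e^{i\theta}$ acts by $e^{i\theta}\cdot(z,w)=(z,e^{i\theta}w)$. An element of $\mathbb{P}\mathrm{SL}(2,\mathbb{R})$ acts through a representative in $\mathrm{SL}(2,\mathbb{R})$; the two representatives $\pm P$ differ by the rotation $(z,w)\mapsto(z,-w)$. *)

(* Defs.v *)
From HB Require Import structures.
From mathcomp Require Import all_boot all_order all_algebra.
From mathcomp Require Import all_classical all_reals all_analysis.
From mathcomp Require Import complex.

Set Implicit Arguments.
Unset Strict Implicit.
Unset Printing Implicit Defensive.

Import Order.TTheory GRing.Theory Num.Theory.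
Import numFieldNormedType.Exports.

Local Open Scope classical_set_scope.
Local Open Scope ring_scope.
Local Open Scope complex_scope.

(* Only meaningful for U open: then the conditions depend on F restricted to U
   only, whatever junk values F takes outside of U. *)
Fixpoint Ck (R : realType) (V W : normedModType R) (k : nat) (U : set V)
    (F : V -> W) : Prop :=
  if k is k'.+1 then
    (forall p, U p -> differentiable F p) /\
    (forall v : V, Ck k' U (fun p => 'D_v F p))
  else forall p, U p -> {for p, continuous F}.

Definition smooth (R : realType) (V W : normedModType R) (U : set V)
    (F : V -> W) : Prop :=
  forall k, Ck k U F.

Section Isometry.
Variables (R : realType) (n : nat).
Implicit Types (U : set 'rV[R]_n) (h : 'rV[R]_n -> 'rV[R]_n).

Definition diffeomorphism U h : Prop :=
  exists h' : 'rV[R]_n -> 'rV[R]_n,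
    [/\ forall p, U p -> U (h p), forall p, U p -> U (h' p),
        smooth U h, smooth U h' &
        forall p, U p -> h' (h p) = p /\ h (h' p) = p].

Definition gram_form (G : 'M[R]_n) (X Y : 'rV[R]_n) : R :=
  (X *m G *m Y^T) 0 0.

(* g p is the Gram matrix at p of a pseudo-Riemannian metric on the open set U,
   in the coordinate basis. *)
Definition metric_isometry (g : 'rV[R]_n -> 'M[R]_n) U h : Prop :=
  diffeomorphism U h /\
  forall p, U p -> forall X Y : 'rV[R]_n,
    gram_form (g (h p)) ('d h p X) ('d h p Y) = gram_form (g p) X Y.

End Isometry.

Section UpperHalfPlaneTimesC.
Variable R : realType.

(* A point (z, w) of H^2 x C, with z = x + iy and w = u + iv, is represented by
   the row vector (x, y, u, v). *)
Definition zcoord (p : 'rV[R]_4) : R[i] := p 0 0 +i* p 0 1.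
Definition wcoord (p : 'rV[R]_4) : R[i] := p 0 2 +i* p 0 3.

Definition zw_point (z w : R[i]) : 'rV[R]_4 :=
  \row_j nth 0 [:: complex.Re z; complex.Im z; complex.Re w; complex.Im w] j.

Definition HxC : set 'rV[R]_4 := [set p | 0 < complex.Im (zcoord p)].

(* f : [0, +oo[ -> R is given as a function on R; its derivative is evaluated
   at y^3 (u^2 + v^2), which is 0 on the zero section, so f has to be a smooth
   extension to a neighbourhood of 0. *)
Definition gmetric (f : R -> R) (p : 'rV[R]_4) : 'M[R]_4 :=
  let y := p 0 1 in let u := p 0 2 in let v := p 0 3 in
  let t := y ^+ 3 * (u ^+ 2 + v ^+ 2) in
  let F := f t in let F' := (f^`())%classic t in
  let d := (1 - F + 3 * (u ^+ 2 + v ^+ 2) * y ^+ 3 * F') / y ^+ 2 in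
  let e := 4 / 3 * F' * y ^+ 3 in
  let a := 2 * F' * v * y ^+ 2 in
  let b := 2 * F' * u * y ^+ 2 in
  \matrix_(i, j) nth 0 (nth [::]
    [:: [:: d;   0; a; - b];
        [:: 0;   d; b;   a];
        [:: a;   b; e;   0];
        [:: - b; a; 0;   e]] i) j.

(* For P of determinant 1. *)
Definition SL2_act (P : 'M[R]_2) (p : 'rV[R]_4) : 'rV[R]_4 :=
  let z := zcoord p in let w := wcoord p in
  let cz_d := (P 1 0)%:C * z + (P 1 1)%:C in
  zw_point (((P 0 0)%:C * z + (P 0 1)%:C) / cz_d) (cz_d ^+ 3 * w).

Definition S1_act (theta : R) (p : 'rV[R]_4) : 'rV[R]_4 :=
  zw_point (zcoord p) ((cos theta +i* sin theta) * wcoord p).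

Definition h1 (p : 'rV[R]_4) : 'rV[R]_4 :=
  zw_point (- conjc (zcoord p)) (wcoord p).

Definition h2 (p : 'rV[R]_4) : 'rV[R]_4 :=
  zw_point (zcoord p) (conjc (wcoord p)).

End UpperHalfPlaneTimesC.

(* Main.v *)
Require Import Defs.
From HB Require Import structures.
From mathcomp Require Import all_boot all_order all_algebra.
From mathcomp Require Import all_classical all_reals all_analysis.
From mathcomp Require Import complex ring lra.

Set Implicit Arguments.
Unset Strict Implicit.
Unset Printing Implicit Defensive.

Import Order.TTheory GRing.Theory Num.Theory.
Import numFieldNormedType.Exports.

Local Open Scope classical_set_scope.
Local Open Scope ring_scope.

(** Put [T = k y^3 |w|^2] and [Dw = dw - (3i/2) (w/y) dz].  For [f(t) = -kt]
    the metric is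
<<
      g = (1 + T) |dz|^2 / y^2  -  (4/3) k y^3 |Dw|^2,
>>
    the Kaehler metric given by the hyperbolic metric of the base and a
    Hermitian line bundle over it.  Its scalar curvature is [4 / (1 + T)]
    ([scalar_curvature]), so that every isometry [h] preserves [T]
    ([normsq_invariant]).  This already determines the shape of [h]: the
    gradient of [T] is a constant multiple of the radial field
    [u d/du + v d/dv], hence [h] maps the radial field to itself
    ([radial_equivariant]).  Following the integral curves of this field,
    [h] maps fibers to fibers and is homogeneous of degree one on them; being
    differentiable at [w = 0] it is linear on them
    ([isometry_base_ray], [isometry_fiber_ray]):
<<
      h (z, w) = (phi z, L(z) w).
>>
    It remains to find [phi] and [L] along the zero section, where [h] is
    controlled by two consequences of being an isometry: it intertwines the
    Levi-Civita connections ([djacE]) and the curvatures ([curv_equivariant]).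

    The first one says that [y / Im phi] has the second derivatives of a
    quadratic polynomial [c (x^2 + y^2) + b x + a], and the conformality of
    [phi] forces [b^2 = 4 a c]; hence [Im phi = y / |g zeta + dl|^2], where
    [zeta] is [z] or [- conj z] according to the orientation of [phi], and
    [phi] is a Moebius transformation of [zeta] ([half_plane_isometry]).  The
    second one forces [L(z)] to be complex linear or antilinear according to
    the same orientation ([jac_fiber_orientation]), and the first one, applied
    to the fiber directions, makes [L / (g zeta + dl)^3] constant
    ([fiber_factor]); this constant has modulus one because [T] is preserved.
    Thus [h] is [P o e^(i theta)] or [P o e^(i theta) o h1 o h2]. *)

(** * Differential calculus in one and several variables *)

Section Calculus.
Variable R : realType.
Implicit Types (V W : normedModType R).

Lemma is_derive_line V W (f : V -> W) (p v : V) (s : R) (d : W) :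
  is_derive (p + s *: v) v f d ->
  is_derive s 1 (fun t : R => f (p + t *: v)) d.
Proof.
have e : (fun h : R => h^-1 *: ((f \o shift (p + s *: v)) (h *: v)
             - f (p + s *: v))) =
         (fun h : R => h^-1 *: (((fun t : R => f (p + t *: v)) \o shift s)
             (h *: (1 : R)) - f (p + s *: v))).
  apply/funext => h /=; congr (_ *: (f _ - _)).
  by rewrite [h *: 1]mulr1 scalerDl addrCA.
by move=> [dv <-]; split; move: dv; rewrite /derivable /derive /= e.
Qed.

Lemma is_derive_continuous (f : R -> R) (x d : R) :
  is_derive x 1 f d -> {for x, continuous f}.
Proof.
by move=> [df _]; apply/differentiable_continuous; rewrite -derivable1_diffP.
Qed.

Lemma MVT_is_derive (f df : R -> R) (a b : R) : a < b ->
  (forall x, x \in `[a, b] -> is_derive x 1 f (df x)) ->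
  exists2 c, c \in `[a, b] & f b - f a = df c * (b - a).
Proof.
move=> ab dfE.
have dfo (x : R) : x \in `]a, b[ -> is_derive x 1 f (df x).
  by move=> /subset_itv_oo_cc; exact: dfE.
have cf : {within `[a, b], continuous f}.
  apply: continuous_in_subspaceT => x; rewrite inE /= => /dfE.
  exact: is_derive_continuous.
have [c cab e] := MVT ab dfo cf.
by exists c => //; exact: subset_itv_oo_cc.
Qed.

Lemma derive0_cst_pos (f : R -> R) :
  (forall x : R, 0 < x -> is_derive x (1 : R) f 0) ->
  forall a b, 0 < a -> 0 < b -> f a = f b.
Proof.
move=> df; have key a b : 0 < a -> a < b -> f a = f b.
  move=> a0 ab; have pos (x : R) : x \in `[a, b] -> 0 < x.
    by rewrite in_itv /= => /andP[ax _]; exact: lt_le_trans ax.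
  have dfab (x : R) : x \in `[a, b] -> is_derive x (1 : R) f 0 by move=> /pos/df.
  have [c _] := MVT_is_derive ab dfab.
  by rewrite mul0r => /eqP; rewrite subr_eq0 => /eqP.
move=> a b a0 b0; have [ab|ba|->//] := ltgtP a b; first exact: key.
by apply/esym; exact: key.
Qed.

(** By continuity, the value at 0 is the limit from the right. *)
Lemma continuous0_cst_pos (f : R -> R) (c : R) :
  {for 0, continuous f} -> (forall x : R, 0 < x -> f x = c) -> f 0 = c.
Proof.
move=> cf fc; apply/eqP; case: eqP => // /eqP; rewrite -subr_eq0 -normr_gt0.
move=> e0; have /cvgrPdist_lt/(_ _ e0) [d /= d0 /(_ (d / 2))] := cf.
have d20 : 0 < d / 2 by rewrite divr_gt0.
rewrite (fc _ d20) ltxx => H; apply: H.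
by rewrite /ball_ /= sub0r normrN gtr0_norm//; lra.
Qed.

Section Schwarz.
Variables (V : normedModType R) (U : set V).
Implicit Types f : V -> R.

(** The second difference of [f] over a parallelogram, computed by the mean
    value theorem in direction [v] and then in direction [w]. *)
Lemma mixed_difference_mean f fv fvw (p v w : V) (s : R) : 0 < s ->
  (forall q, U q -> is_derive q v f (fv q)) ->
  (forall q, U q -> is_derive q w fv (fvw q)) ->
  (forall a b, a \in `[0, s] -> b \in `[0, s] -> U (p + a *: v + b *: w)) ->
  exists a b, [/\ a \in `[0, s], b \in `[0, s] &
    f (p + s *: v + s *: w) - f (p + s *: v) - (f (p + s *: w) - f p)
      = fvw (p + a *: v + b *: w) * s ^+ 2].
Proof.
move=> s0 dv dvw Upvw.
have i0 : 0 \in `[0, s] by rewrite in_itv /= lexx ltW.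
have ss : s \in `[0, s] by rewrite in_itv /= lexx ltW.
have Upv a : a \in `[0, s] -> U (p + a *: v).
  by move=> ia; have := Upvw a 0 ia i0; rewrite scale0r addr0.
have d1 (a : R) : a \in `[0, s] -> is_derive a 1
    (fun a => f (p + s *: w + a *: v) - f (p + a *: v))
    (fv (p + s *: w + a *: v) - fv (p + a *: v)).
  move=> ia; have := Upv _ ia; have := Upvw a s ia ss.
  rewrite addrAC => /dv/is_derive_line d1 /dv/is_derive_line d2.
  exact: is_deriveB.
have [a ia] := MVT_is_derive s0 d1.
have d2 (b : R) : b \in `[0, s] -> is_derive b 1
    (fun b => fv (p + a *: v + b *: w)) (fvw (p + a *: v + b *: w)).
  by move=> ib; apply/is_derive_line/dvw/Upvw.
have [b ib] := MVT_is_derive s0 d2.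
rewrite !scale0r !addr0 subr0 (addrAC p (s *: w) (a *: v)) => ->.
rewrite [p + s *: w + _]addrAC => e.
by exists a, b; split => //; rewrite expr2 mulrA -e; lra.
Qed.

(** Both iterated derivatives are limits of the same second difference.  The
    derivatives are given by functions that are only known on [U], so that the
    result can be applied to the coordinates of a map defined on [U]. *)
Lemma schwarz f fv fw fvw fwv (p v w : V) : open U -> U p ->
  (forall q, U q -> is_derive q v f (fv q)) ->
  (forall q, U q -> is_derive q w f (fw q)) ->
  (forall q, U q -> is_derive q w fv (fvw q)) ->
  (forall q, U q -> is_derive q v fw (fwv q)) ->
  {for p, continuous fvw} -> {for p, continuous fwv} -> fvw p = fwv p.
Proof.
move=> oU Up dv dw dvw dwv cvw cwv; apply/eqP; case: eqP => // /eqP.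
rewrite -subr_eq0 -normr_gt0 => e0; set e := `|_| in e0.
have e20 : 0 < e / 2 by rewrite divr_gt0.
have near1 : nbhs p [set q | `|fvw p - fvw q| < e / 2].
  by move/cvgrPdist_lt : cvw; exact.
have near2 : nbhs p [set q | `|fwv p - fwv q| < e / 2].
  by move/cvgrPdist_lt : cwv; exact.
have near3 : nbhs p U by exact: open_nbhs_nbhs.
pose A := U `&` ([set q | `|fvw p - fvw q| < e / 2] `&`
                 [set q | `|fwv p - fwv q| < e / 2]).
have nearA : nbhs p A by apply: filterI => //; exact: filterI.
have /nbhs_ballP[r /= r0 ballr] := nearA.
pose m := `|v| + `|w| + 1.
have m0 : 0 < m by rewrite ltr_wpDl// addr_ge0.
(* Small enough for the whole parallelogram to lie in the ball. *)
pose s := r / 2 / m.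
have s0 : 0 < s by rewrite !divr_gt0.
have inb a b : a \in `[0, s] -> b \in `[0, s] ->
    ball p r (p + a *: v + b *: w).
  rewrite !in_itv /= => /andP[a0 as_] /andP[b0 bs].
  rewrite -ball_normE /= -addrA opprD addNKr normrN.
  rewrite (le_lt_trans (ler_normD _ _))// !normrZ !ger0_norm//.
  apply: (@le_lt_trans _ _ (s * m)); last by rewrite divfK ?gt_eqF//; lra.
  rewrite /m !mulrDr -[leLHS]addr0 !lerD// ?ler_wpM2r// mulr1; exact: ltW.
have U1 (a b : R) : a \in `[0, s] -> b \in `[0, s] -> U (p + a *: v + b *: w).
  by move=> ia ib; have [] := ballr _ (inb _ _ ia ib).
have U2 (b a : R) : b \in `[0, s] -> a \in `[0, s] -> U (p + b *: w + a *: v).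
  by move=> ib ia; rewrite addrAC; exact: U1.
have [a [b [ia ib e1]]] := mixed_difference_mean s0 dv dvw U1.
have [b' [a' [ib' ia' e2]]] := mixed_difference_mean s0 dw dwv U2.
have [_ [n1 _]] := ballr _ (inb _ _ ia ib).
have [_ [_ n2]] := ballr _ (inb _ _ ia' ib').
(* Both sides are the second difference divided by [s ^+ 2]. *)
have E : fvw (p + a *: v + b *: w) = fwv (p + a' *: v + b' *: w).
  have s2 : s ^+ 2 != 0 by rewrite expf_neq0// gt_eqF.
  apply: (mulIf s2); rewrite -e1 [_ + a' *: v + _]addrAC -e2.
  by rewrite [p + s *: w + _]addrAC; lra.
move: n1 n2 => /= n1 n2; rewrite -E in n2.
suff : e < e by rewrite ltxx.
rewrite {1}/e; set x := fvw p in n1 *; set z := fwv p in n2 *.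
set t := fvw _ in n1 n2.
have -> : x - z = (x - t) - (z - t) by lra.
rewrite (le_lt_trans (ler_normB _ _))//; lra.
Qed.

End Schwarz.

End Calculus.

Section MatrixCalculus.
Variables (R : realType) (V : normedModType R).

Lemma is_derive_mx m n (M : V -> 'M[R]_(m, n)) (dM : 'M[R]_(m, n)) (p v : V) :
  is_derive p v M dM <->
  forall i j, is_derive p v (fun q => M q i j) (dM i j).
Proof.
split=> [[dv <-] i j|dMij].
  by split; [exact: (derivable_mxP _ _ _).1|rewrite derive_mx// mxE].
have dv : derivable M p v by apply/derivable_mxP => i j; exact: ex_derive.
split=> //; rewrite derive_mx//; apply/matrixP => i j; rewrite mxE.
exact: derive_val.
Qed.

Lemma is_derive_mulmx m n q (M : V -> 'M[R]_(m, n)) (N : V -> 'M[R]_(n, q))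
    dM dN (p v : V) :
  is_derive p v M dM -> is_derive p v N dN ->
  is_derive p v (fun x => M x *m N x) (dM *m N p + M p *m dN).
Proof.
move=> /is_derive_mx dMij /is_derive_mx dNij; apply/is_derive_mx => i j.
have -> : (fun x => (M x *m N x) i j) =
    \sum_(l < n) ((fun x => M x i l) * (fun x => N x l j)).
  by apply/funext => x; rewrite mxE fct_sumE.
have d l := is_deriveM (dMij i l) (dNij l j).
apply: is_derive_eq (is_derive_sum d) _.
rewrite !mxE -big_split /=; apply: eq_bigr => l _.
by rewrite addrC; congr (_ + _); exact: mulrC.
Qed.

Lemma is_derive_trmx m n (M : V -> 'M[R]_(m, n)) dM (p v : V) :
  is_derive p v M dM -> is_derive p v (fun x => (M x)^T) dM^T.
Proof.
move=> /is_derive_mx dMij; apply/is_derive_mx => i j; rewrite mxE.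
have -> : (fun x => (M x)^T i j) = (fun x => M x j i).
  by apply/funext => x; rewrite mxE.
exact: dMij.
Qed.

Lemma is_derive_comp_rV n (F : 'rV[R]_n -> R) (h : V -> 'rV[R]_n)
    (p v : V) :
  differentiable h p -> differentiable F (h p) ->
  is_derive p v (F \o h)
    (\sum_a ('D_v h p) 0 a * 'D_(delta_mx 0 a) F (h p)).
Proof.
move=> dh dF; have dFh : differentiable (F \o h) p.
  exact: differentiable_comp.
split; first exact: diff_derivable.
rewrite deriveE// diff_comp//= -(deriveE _ dh) [in LHS](row_sum_delta ('D_v h p)).
rewrite linear_sum /=; apply: eq_bigr => a _.
by rewrite linearZ /= (deriveE _ dF).
Qed.

End MatrixCalculus.

Section SmoothMaps.
Variables (R : realType) (n : nat) (U : set 'rV[R]_n).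
Hypothesis oU : open U.

Lemma continuous_coord m (F : 'rV[R]_n -> 'rV[R]_m) p a :
  {for p, continuous F} -> {for p, continuous (fun q => F q 0 a)}.
Proof.
move=> cF; apply: (@continuous_comp _ _ _ F (fun r : 'rV[R]_m => r 0 a) p cF).
exact: coord_continuous.
Qed.

Lemma derive_comm m (F : 'rV[R]_n -> 'rV[R]_m) (v w p : 'rV[R]_n) :
  Ck 2 U F -> U p ->
  'D_w (fun q => 'D_v F q) p = 'D_v (fun q => 'D_w F q) p.
Proof.
move=> [dF dF2] Up; apply/rowP => a.
have d1 u q : U q -> is_derive q u (fun x => F x 0 a) ('D_u F q 0 a).
  move=> Uq; have := diff_derivable (v := u) (dF _ Uq) => /derivableP.
  by move/is_derive_mx; exact.
have d2 u u' q : U q -> is_derive q u' (fun x => 'D_u F x 0 a)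
    ('D_u' (fun x => 'D_u F x) q 0 a).
  move=> Uq; have [d _] := dF2 u.
  have := diff_derivable (v := u') (d _ Uq) => /derivableP.
  by move/is_derive_mx; exact.
have c u u' : {for p, continuous (fun q => 'D_u' (fun x => 'D_u F x) q 0 a)}.
  by have [_ cc] := dF2 u; exact: continuous_coord (cc u' _ Up).
exact: (schwarz oU Up (d1 v) (d1 w) (d2 v w) (d2 w v) (c v w) (c w v)).
Qed.

End SmoothMaps.

(** * Equivariance of the connection and of the curvature *)

Section LinearAlgebra.
Variables (R : realType) (n : nat).
Implicit Types (J H : 'M[R]_n) (A At D : 'I_n -> 'M[R]_n).

Lemma scalemxE (c : R) (M : 'M[R]_n) i j : (c *: M) i j = c * M i j.
Proof. by rewrite mxE. Qed.

(** Uniqueness of the Levi-Civita connection, read through the Jacobian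
    matrix [J] of an isometry: [A] is the connection of the source, [At] the
    pull-back of the connection of the target, [H] the metric of the target and
    [D] the derivatives of [J].  The tensor [K] below measures the defect of
    the conclusion.  It is symmetric in its first two indices because both
    connections are torsion-free, and antisymmetric in its last two because
    both are metric; such a tensor vanishes. *)
Lemma levi_civita_unique J H A At D :
  (forall i j m, D i j m = D j i m) -> (forall i j m, A i j m = A j i m) ->
  (forall i j m, (J *m At i) j m = (J *m At j) i m) ->
  H^T = H -> H *m J^T \in unitmx ->
  (forall i, (D i *m H + J *m (At i *m H + H *m (At i)^T)) *m J^T
      + J *m H *m (D i)^T
    = A i *m (J *m H *m J^T) + J *m H *m J^T *m (A i)^T) ->
  forall i, D i = A i *m J - J *m At i.
Proof.
move=> Ds As Ats Hs HJu E i.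
pose B j := D j - (A j *m J - J *m At j).
pose K j := B j *m (H *m J^T).
have Bs j l m : B j l m = B l j m.
  rewrite /B !mxE Ds; congr (_ - (_ - _)).
    by apply: eq_bigr => a _; rewrite As.
  by have := Ats j l m; rewrite !mxE.
have Ks j l m : K j l m = K l j m.
  by rewrite !mxE; apply: eq_bigr => a _; rewrite Bs.
have K_anti j : K j + (K j)^T = 0.
  have tB : (B j)^T = (D j)^T - (J^T *m (A j)^T - (At j)^T *m J^T).
    by rewrite /B !raddfB /= !trmx_mul.
  have := E j; rewrite /K !trmx_mul trmxK Hs tB /B.
  rewrite !(mulmxBl, mulmxBr, mulmxDl, mulmxDr) !mulmxA.
  set a := D j *m _ *m _; set b := J *m At j *m _ *m _.
  set c := J *m _ *m (At j)^T *m _; set d := J *m _ *m (D j)^T.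
  set e := A j *m _ *m _ *m _; set f := J *m _ *m _ *m (A j)^T.
  move: a b c d e f => a b c d e f /matrixP abcd.
  by apply/matrixP => x y; move: (abcd x y); rewrite !mxE; lra.
(* Alternating the two symmetries three times gives [K = - K]. *)
have K0 j l m : K j l m = 0.
  have as_ a b c : K a b c = - K a c b.
    apply/eqP; rewrite -addr_eq0; have /matrixP/(_ b c) := K_anti a.
    by rewrite !mxE => ->.
  have : K j l m = - K j l m.
    rewrite [LHS]as_ [X in - X]Ks [X in - X]as_ opprK.
    by rewrite [LHS]Ks [LHS]as_ [X in - X]Ks.
  lra.
have Ki : K i = 0 by apply/matrixP => l m; rewrite K0 mxE.
apply/eqP; rewrite -subr_eq0 -/(B i); apply/eqP.
by rewrite -[B i](mulmxK HJu) -/(K i) Ki mul0mx.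
Qed.

(** The integrability condition of the system [dJ = A J - J P]: the hypothesis
    equates the two mixed derivatives of [J]. *)
Lemma curvature_intertwining J (Ai Al Pi Pl dlAi diAl dlPi diPl : 'M[R]_n) :
  dlAi *m J + Ai *m (Al *m J - J *m Pl)
    - ((Al *m J - J *m Pl) *m Pi + J *m dlPi)
  = diAl *m J + Al *m (Ai *m J - J *m Pi)
    - ((Ai *m J - J *m Pi) *m Pl + J *m diPl) ->
  (dlAi - diAl + (Ai *m Al - Al *m Ai)) *m J
  = J *m (dlPi - diPl + (Pi *m Pl - Pl *m Pi)).
Proof.
rewrite !(mulmxBl, mulmxBr, mulmxDl, mulmxDr, mulNmx, mulmxN) !mulmxA.
set a := dlAi *m _; set b := diAl *m _; set c := J *m dlPi.
set d := J *m diPl; set e := Ai *m Al *m _; set f := Al *m Ai *m _.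
set g := Ai *m J *m _; set o := Al *m J *m _.
set r := J *m Pi *m _; set s := J *m Pl *m _.
move: a b c d e f g o r s => a b c d e f g o r s /matrixP abcd.
by apply/matrixP => x y; move: (abcd x y); rewrite !mxE; lra.
Qed.

End LinearAlgebra.

Section Equivariance.
Variables (R : realType) (n : nat) (U : set 'rV[R]_n).
Variable h : 'rV[R]_n -> 'rV[R]_n.
Hypotheses (oU : open U) (hU : forall p, U p -> U (h p)) (hC : Ck 3 U h).

Local Notation ee i := (delta_mx 0 i : 'rV[R]_n).

(** Row [i] is the image of the [i]-th basis vector: matrices act on tangent
    vectors, seen as rows, from the right. *)
Definition jac (p : 'rV[R]_n) : 'M[R]_n := \matrix_(i, a) 'D_(ee i) h p 0 a.

Definition djac (l : 'I_n) (p : 'rV[R]_n) : 'M[R]_n :=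
  \matrix_(i, a) 'D_(ee l) (fun q => 'D_(ee i) h q) p 0 a.

Lemma djac_entry l p i a :
  djac l p i a = 'D_(ee l) (fun q => 'D_(ee i) h q) p 0 a.
Proof. by rewrite mxE. Qed.

Let h_diff p : U p -> differentiable h p.
Proof. by case: hC => + _; apply. Qed.

Let Dh_diff v p : U p -> differentiable (fun q => 'D_v h q) p.
Proof. by case: hC => _ /(_ v)[+ _]; apply. Qed.

Let DDh_diff v w p : U p ->
  differentiable (fun q => 'D_w (fun r => 'D_v h r) q) p.
Proof. by case: hC => _ /(_ v)[_ /(_ w)[+ _]]; apply. Qed.

Let hC2 : Ck 2 U h.
Proof.
have [d c] := hC; split=> // v; have [dv cv] := c v; split=> // w p Up.
have [dw _] := cv w; exact/differentiable_continuous/dw.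
Qed.

Lemma is_derive_jac l p : U p -> is_derive p (ee l) jac (djac l p).
Proof.
move=> Up; apply/is_derive_mx => i a; rewrite mxE.
have -> : (fun q => jac q i a) = (fun q => 'D_(ee i) h q 0 a).
  by apply/funext => q; rewrite mxE.
have /derivableP := diff_derivable (v := ee l) (Dh_diff (ee i) Up).
by move/is_derive_mx; exact.
Qed.

Lemma djac_sym l i a p : U p -> djac l p i a = djac i p l a.
Proof. move=> Up; have e := derive_comm oU (ee i) (ee l) hC2 Up.
have ea := congr1 (fun M : 'rV[R]_n => M 0 a) e.
exact: etrans (djac_entry l p i a) (etrans ea (esym (djac_entry i p l a))). Qed.

(** Third derivatives of [h] commute in the two outer directions. *)
Lemma djac_derive_comm l m p : U p ->
  exists D, is_derive p (ee m) (djac l) D /\ is_derive p (ee l) (djac m) D.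
Proof.
move=> Up.
have [D De] : exists D : 'M[R]_n, forall i a,
    D i a = 'D_(ee m) (fun r => 'D_(ee l) (fun q => 'D_(ee i) h q) r) p 0 a.
  by eexists (\matrix_(i, a) _) => i a; rewrite mxE.
have d l' m' i a : is_derive p (ee m') (fun q => djac l' q i a)
    ('D_(ee m') (fun r => 'D_(ee l') (fun q => 'D_(ee i) h q) r) p 0 a).
  have -> : (fun q => djac l' q i a) =
      (fun q => 'D_(ee l') (fun r => 'D_(ee i) h r) q 0 a).
    by apply/funext => q; rewrite mxE.
  have /derivableP := diff_derivable (v := ee m') (DDh_diff (ee i) (ee l') Up).
  by move/is_derive_mx; exact.
have [_ Ci] := hC.
exists D; split; apply/is_derive_mx => i a; rewrite De; first exact: d.
have e := derive_comm oU (ee l) (ee m) (Ci (ee i)) Up.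
apply: is_derive_eq (d m l i a) _.
exact: (congr1 (fun M : 'rV[R]_n => M 0 a) (esym e)).
Qed.

Lemma is_derive_comp_jac (F : 'rV[R]_n -> R) i p :
  U p -> differentiable F (h p) ->
  is_derive p (ee i) (F \o h) (\sum_a jac p i a * 'D_(ee a) F (h p)).
Proof.
move=> Up dF; apply: is_derive_eq (is_derive_comp_rV _ (h_diff Up) dF) _.
by apply: eq_bigr => a _; rewrite mxE.
Qed.

Lemma is_derive_comp_jac_mx (M : 'rV[R]_n -> 'M[R]_n) dM i p :
  U p -> (forall j m, differentiable (fun q => M q j m) (h p)) ->
  (forall a, is_derive (h p) (ee a) M (dM a)) ->
  is_derive p (ee i) (fun q => M (h q)) (\sum_a jac p i a *: dM a).
Proof.
move=> Up dMjm dMa; apply/is_derive_mx => j m.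
apply: is_derive_eq (is_derive_comp_jac i Up (dMjm j m)) _.
rewrite summxE; apply: eq_bigr => a _; rewrite [RHS]mxE.
by have /is_derive_mx/(_ j m)[_ ->] := dMa a.
Qed.

Variables (G : 'rV[R]_n -> 'M[R]_n) (A : 'I_n -> 'rV[R]_n -> 'M[R]_n).
Hypotheses (G_diff : forall p, U p ->
    forall j m, differentiable (fun q => G q j m) p)
  (A_diff : forall p, U p ->
    forall i j m, differentiable (fun q => A i q j m) p)
  (A_torsion_free : forall p, U p -> forall i j m, A i p j m = A j p i m)
  (A_metric : forall p, U p -> forall i,
    is_derive p (ee i) G (A i p *m G p + G p *m (A i p)^T))
  (G_sym : forall p, (G p)^T = G p)
  (G_unit : forall p, U p -> G p \in unitmx)
  (h_isom : forall p, U p -> jac p *m G (h p) *m (jac p)^T = G p).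

(** The connection form of the target, pulled back by [h]. *)
Definition pullconn i p := \sum_a jac p i a *: A a (h p).

Lemma jac_unit p : U p -> jac p \in unitmx.
Proof.
move=> Up; have := G_unit Up; rewrite -(h_isom Up) -mulmxA unitmx_mul.
by case/andP.
Qed.

(** An isometry is affine.  The metric identity [h_isom] is differentiated
    along [e_i] to reach the hypotheses of [levi_civita_unique]. *)
Lemma djacE i p : U p -> djac i p = A i p *m jac p - jac p *m pullconn i p.
Proof.
move=> Up; have Uhp := hU Up.
apply: (@levi_civita_unique _ _ (jac p) (G (h p)) (A^~ p) (pullconn^~ p)
  (djac^~ p)).
- by move=> j l m; exact: djac_sym.
- exact: A_torsion_free.
- move=> j l m.
  have e a b : (jac p *m pullconn a p) b m =
      \sum_c \sum_d jac p b c * jac p a d * A d (h p) c m.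
    rewrite mxE; apply: eq_bigr => c _; rewrite summxE mulr_sumr.
    by apply: eq_bigr => d _; rewrite scalemxE mulrA.
  rewrite !e exchange_big /=; apply: eq_bigr => c _; apply: eq_bigr => d _.
  by rewrite (A_torsion_free Uhp) [jac p l d * _]mulrC.
- exact: G_sym.
- by rewrite unitmx_mul G_unit// unitmx_tr jac_unit.
move=> j.
have dJ := is_derive_jac j Up.
have dGh := is_derive_comp_jac_mx j Up (G_diff Uhp) (A_metric Uhp).
have dJGJ := is_derive_mulmx (is_derive_mulmx dJ dGh) (is_derive_trmx dJ).
have near_iso : \forall q \near p, jac q *m G (h q) *m (jac q)^T = G q.
  have : nbhs p U by exact: open_nbhs_nbhs.
  exact: filterS.
have [_ E1] := near_eq_is_derive near_iso dJGJ.
have [_ E2] := A_metric Up j.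
rewrite (h_isom Up) -E2 E1; congr ((_ + _ *m _) *m _ + _).
rewrite /pullconn mulmx_suml linear_sum mulmx_sumr -big_split /=.
apply: eq_bigr => a _.
by rewrite linearZ /= -scalemxAl -scalemxAr scalerDr.
Qed.

Let dA l i p := 'D_(ee l) (A i) p.

(** Since the connection matrices act on rows from the right, this is the
    matrix of the curvature operator [R(e_l, e_i)]. *)
Definition curv i l p :=
  dA l i p - dA i l p + (A i p *m A l p - A l p *m A i p).

Lemma is_derive_conn l i p : U p -> is_derive p (ee l) (A i) (dA l i p).
Proof.
move=> Up; split=> //; apply/derivable_mxP => j m.
exact/diff_derivable/A_diff.
Qed.

Lemma is_derive_pullconn l i p : U p ->
  is_derive p (ee l) (pullconn i) (\sum_a (djac l p i a *: A a (h p)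
    + \sum_b (jac p i a * jac p l b) *: dA b a (h p))).
Proof.
move=> Up; have Uhp := hU Up; apply/is_derive_mx => j m.
have -> : (fun q => pullconn i q j m) =
    \sum_a ((fun q => jac q i a) * ((fun q => A a q j m) \o h)).
  apply/funext => q; rewrite fct_sumE /pullconn summxE.
  by apply: eq_bigr => a _; rewrite scalemxE.
have d a := is_deriveM ((is_derive_mx _ _ _ _).1 (is_derive_jac l Up) i a)
  (is_derive_comp_jac l Up (A_diff Uhp a j m)).
apply: is_derive_eq (is_derive_sum d) _.
rewrite summxE; apply: eq_bigr => a _; rewrite [RHS]mxE scalemxE summxE addrC.
congr (_ + _); last exact: mulrC.
rewrite scaler_sumr; apply: eq_bigr => b _.
rewrite scalemxE -mulrA; congr (_ * (_ * _)).
by have /is_derive_mx/(_ j m)[_ ->] := is_derive_conn b a Uhp.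
Qed.

Lemma curv_pullconn i l p : U p ->
  \sum_a (djac l p i a *: A a (h p)
    + \sum_b (jac p i a * jac p l b) *: dA b a (h p))
  - \sum_a (djac i p l a *: A a (h p)
    + \sum_b (jac p l a * jac p i b) *: dA b a (h p))
  + (pullconn i p *m pullconn l p - pullconn l p *m pullconn i p)
  = \sum_a \sum_b (jac p i a * jac p l b) *: curv a b (h p).
Proof.
move=> Up.
have prod i' l' : pullconn i' p *m pullconn l' p =
    \sum_a \sum_b (jac p i' a * jac p l' b) *: (A a (h p) *m A b (h p)).
  rewrite mulmx_suml; apply: eq_bigr => a _; rewrite mulmx_sumr.
  by apply: eq_bigr => b _; rewrite -scalemxAl -scalemxAr scalerA.
rewrite !prod !big_split /=.
rewrite (eq_bigr (fun a => djac i p l a *: A a (h p))) => [|a _]; last first.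
  (* The second derivatives of [h] drop out by symmetry. *)
  exact: (congr1 (fun c => c *: A a (h p)) (djac_sym l i a Up)).
rewrite opprD [X in X + _]addrACA subrr add0r.
rewrite [X in _ - X + _]exchange_big [X in _ + (_ - X)]exchange_big.
rewrite /= -!sumrB -big_split /=; apply: eq_bigr => a _.
rewrite -!sumrB -big_split /=; apply: eq_bigr => b _.
by rewrite ![jac p l b * _]mulrC -!scalerBr -scalerDr.
Qed.

(** The mixed second derivatives of [jac h], computed from [djacE], agree. *)
Theorem curv_equivariant i l p : U p ->
  curv i l p *m jac p
  = jac p *m \sum_a \sum_b (jac p i a * jac p l b) *: curv a b (h p).
Proof.
move=> Up; rewrite -curv_pullconn//; apply: curvature_intertwining.
have near_djac i' : \forall q \near p,
    A i' q *m jac q - jac q *m pullconn i' q = djac i' q.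
  have : nbhs p U by exact: open_nbhs_nbhs.
  by apply: filterS => q Uq; rewrite djacE.
have dd i' l' := near_eq_is_derive (near_djac i')
  (is_deriveB (is_derive_mulmx (is_derive_conn l' i' Up) (is_derive_jac l' Up))
     (is_derive_mulmx (is_derive_jac l' Up) (is_derive_pullconn l' i' Up))).
have [D [[_ D1] [_ D2]]] := djac_derive_comm i l Up.
have [_ E1] := dd i l; have [_ E2] := dd l i.
rewrite -[Y in _ - (Y *m pullconn i p + _) = _](djacE l Up).
rewrite -[Y in _ = _ - (Y *m pullconn l p + _)](djacE i Up).
rewrite -[Y in _ + A i p *m Y - _ = _](djacE l Up).
rewrite -[Y in _ = _ + A l p *m Y - _](djacE i Up).
exact: etrans (esym E1) (etrans D1 (etrans (esym D2) E2)).
Qed.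

(** The trace of the endomorphism [X |-> R(X, e_i) e_j]. *)
Definition ricci p : 'M[R]_n := \matrix_(i, j) \sum_l curv i l p j l.

(** The Jacobian matrix conjugates the endomorphism [X |-> R(X, e_i) e_j],
    written [N] below, to the corresponding one of the target. *)
Theorem ricci_equivariant p : U p ->
  ricci p = jac p *m ricci (h p) *m (jac p)^T.
Proof.
move=> Up.
pose N q i j : 'M[R]_n := \matrix_(l, m) curv i l q j m.
have N_entry q i j l m : N q i j l m = curv i l q j m by rewrite mxE.
have tr_N q i j : \tr (N q i j) = ricci q i j.
  by rewrite [RHS]mxE; apply: eq_bigr => l _; exact: N_entry.
have NJ i j : N p i j *m jac p =
    jac p *m \sum_a \sum_b (jac p i a * jac p j b) *: N (h p) a b.
  apply/matrixP => l m; rewrite [LHS]mxE [RHS]mxE.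
  transitivity ((curv i l p *m jac p) j m).
    by rewrite [RHS]mxE; apply: eq_bigr => b _; rewrite N_entry.
  rewrite curv_equivariant// [LHS]mxE.
  have entries (M : 'I_n -> 'I_n -> 'M[R]_n) (c : 'I_n -> 'I_n -> R) b :
      (\sum_a \sum_d c a d *: M a d) b m = \sum_a \sum_d c a d * M a d b m.
    rewrite summxE; apply: eq_bigr => a _; rewrite summxE.
    by apply: eq_bigr => d _; rewrite scalemxE.
  transitivity (\sum_a \sum_b \sum_c
      jac p j b * (jac p i a * jac p l c * curv a c (h p) b m)).
    rewrite [RHS]exchange_big /=; apply: eq_bigr => b _; rewrite entries mulr_sumr.
    by apply: eq_bigr => a _; rewrite mulr_sumr.
  transitivity (\sum_a \sum_c \sum_b
      jac p l c * (jac p i a * jac p j b * N (h p) a b c m)); last first.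
    rewrite [LHS]exchange_big /=; apply: eq_bigr => c _; rewrite entries mulr_sumr.
    by apply: eq_bigr => a _; rewrite mulr_sumr.
  apply: eq_bigr => a _; rewrite exchange_big /=; apply: eq_bigr => c _.
  by apply: eq_bigr => b _; rewrite N_entry; ring.
have tr_eq i j : \tr (N p i j) =
    \tr (\sum_a \sum_b (jac p i a * jac p j b) *: N (h p) a b).
  have Ju := jac_unit Up.
  by rewrite -[N p i j](mulmxK Ju) NJ mxtrace_mulC mulmxA mulVmx// mul1mx.
apply/matrixP => i j; rewrite -tr_N tr_eq [RHS]mxE raddf_sum /=.
have trans b : (jac p)^T b j = jac p j b by rewrite [LHS]mxE.
transitivity (\sum_a \sum_b jac p i a * jac p j b * ricci (h p) a b).
  apply: eq_bigr => a _; rewrite raddf_sum; apply: eq_bigr => b _.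
  by rewrite /= mxtraceZ tr_N.
rewrite exchange_big /=; apply: eq_bigr => b _; rewrite trans [(_ *m _) i b]mxE.
by rewrite mulr_suml; apply: eq_bigr => a _; rewrite mulrAC.
Qed.

Theorem scalar_curvature_invariant Gi p :
  U p -> (forall q, U q -> G q *m Gi q = 1%:M) ->
  \tr (ricci p *m Gi p) = \tr (ricci (h p) *m Gi (h p)).
Proof.
move=> Up GGi; have Uhp := hU Up; have Ju := jac_unit Up.
have JTu : (jac p)^T \in unitmx by rewrite unitmx_tr.
have e : (jac p)^T *m Gi p = Gi (h p) *m invmx (jac p).
  have Ghu := G_unit Uhp.
  apply: (can_inj (mulKmx Ghu)); apply: (can_inj (mulKmx Ju)).
  rewrite !mulmxA h_isom// GGi// -(mulmxA (jac p)) GGi// mulmx1.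
  by rewrite mulmxV.
rewrite (ricci_equivariant Up) -!mulmxA e mxtrace_mulC -!mulmxA.
by rewrite mulVmx// mulmx1.
Qed.

End Equivariance.

(** * Derivatives of rational expressions, by reflection *)

Section RationalExpressions.
Variable R : realType.

(** Atoms stand for functions whose derivatives are known; a rational
    expression in them is differentiated by computation. *)
Inductive rexp :=
  | Cst of R
  | Atm of nat
  | Add of rexp & rexp
  | Mul of rexp & rexp
  | Inv of rexp.

Fixpoint reval (a : nat -> R) (e : rexp) : R :=
  match e with
  | Cst c => c
  | Atm n => a n
  | Add e1 e2 => reval a e1 + reval a e2
  | Mul e1 e2 => reval a e1 * reval a e2
  | Inv e1 => (reval a e1)^-1
  end.

Fixpoint rdiff (a da : nat -> R) (e : rexp) : R :=
  match e with
  | Cst c => 0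
  | Atm n => da n
  | Add e1 e2 => rdiff a da e1 + rdiff a da e2
  | Mul e1 e2 => rdiff a da e1 * reval a e2 + reval a e1 * rdiff a da e2
  | Inv e1 => - ((reval a e1) ^- 2 * rdiff a da e1)
  end.

Fixpoint rdef (a : nat -> R) (e : rexp) : Prop :=
  match e with
  | Cst _ | Atm _ => True
  | Add e1 e2 | Mul e1 e2 => rdef a e1 /\ rdef a e2
  | Inv e1 => reval a e1 != 0 /\ rdef a e1
  end.

Lemma is_derive_reval (V : normedModType R) (F : nat -> V -> R)
    (dF : nat -> R) (p v : V) (e : rexp) :
  (forall n, is_derive p v (F n) (dF n)) -> rdef (F^~ p) e ->
  is_derive p v (fun q => reval (F^~ q) e) (rdiff (F^~ p) dF e).
Proof.
move=> dFn; elim: e => [c|n|e1 I1 e2 I2|e1 I1 e2 I2|e1 I1] /=.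
- by move=> _; exact: is_derive_cst.
- by move=> _; exact: dFn.
- by move=> [/I1 d1 /I2 d2]; exact: is_deriveD.
- move=> [/I1 d1 /I2 d2]; apply: is_derive_eq (is_deriveM d1 d2) _.
  by rewrite addrC; congr (_ + _); exact: mulrC.
- move=> [n0 /I1 d1]; split; first exact: derivableV.
  by rewrite deriveV//; have [_ ->] := d1; rewrite scaleNr /GRing.scale.
Qed.

Lemma differentiable_reval (V : normedModType R) (F : nat -> V -> R)
    (p : V) (e : rexp) :
  (forall n, differentiable (F n) p) -> rdef (F^~ p) e ->
  differentiable (fun q => reval (F^~ q) e) p.
Proof.
move=> dFn; elim: e => [c|n|e1 I1 e2 I2|e1 I1 e2 I2|e1 I1] /=.
- by move=> _; exact: differentiable_cst.
- by move=> _; exact: dFn.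
- by move=> [/I1 d1 /I2 d2]; exact: differentiableD.
- by move=> [/I1 d1 /I2 d2]; exact: differentiableM.
- by move=> [n0 /I1 d1]; exact: differentiableV.
Qed.

Lemma is_derive_nil (V : normedModType R) (p v : V) (n : nat) :
  is_derive p v (nth (cst 0 : V -> R) [::] n) (nth 0 [::] n).
Proof. by rewrite !nth_nil; exact: is_derive_cst. Qed.

Lemma is_derive_cons (V : normedModType R) (p v : V) f (fs : seq (V -> R)) d ds :
  is_derive p v f d ->
  (forall n, is_derive p v (nth (cst 0) fs n) (nth 0 ds n)) ->
  forall n, is_derive p v (nth (cst 0) (f :: fs) n) (nth 0 (d :: ds) n).
Proof. by move=> ? ? []. Qed.

Lemma is_derive_rexp (V : normedModType R) (p v : V) (fs : seq (V -> R)) ds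
    (e : rexp) (g : V -> R) (d : R) :
  (forall n, is_derive p v (nth (cst 0) fs n) (nth 0 ds n)) ->
  rdef (fun n => nth (cst 0) fs n p) e ->
  (forall q, g q = reval (fun n => nth (cst 0) fs n q) e) ->
  d = rdiff (fun n => nth (cst 0) fs n p) (nth 0 ds) e ->
  is_derive p v g d.
Proof.
move=> dfs dom gE ->.
have -> : g = fun q => reval (fun n => nth (cst 0) fs n q) e by exact/funext.
exact: (is_derive_reval (F := fun n => nth (cst 0) fs n)).
Qed.

End RationalExpressions.

Arguments Atm {R}.

Declare Scope rexp_scope.
Delimit Scope rexp_scope with X.
Bind Scope rexp_scope with rexp.
Notation "x + y" := (Add x y) : rexp_scope.
Notation "x * y" := (Mul x y) : rexp_scope.
Notation "x / y" := (Mul x (Inv y)) : rexp_scope.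

(** * The metric in coordinates, its connection and its curvature *)

Section Metric.
Variables (R : realType) (k : R).
Local Notation rexp := (rexp R).

Local Notation Y := (@Atm R 1).
Local Notation W1 := (@Atm R 2).
Local Notation W2 := (@Atm R 3).

(** Up to the factor [k], the squared norm of [w] in the fiber over [z]. *)
Definition normsq : rexp := (Cst k * Y * Y * Y * (W1 * W1 + W2 * W2))%X.
Local Notation T := normsq.
Local Notation S := (Cst 1 + normsq)%X.

(** The real form of the Hermitian 2x2 matrix with diagonal entries [d], [e]
    and off-diagonal entry [a - i b]; a complex number [c1 + i c2] becomes the
    block [[c1, c2], [- c2, c1]]. *)
Definition hermitian (d a b e : rexp) : seq (seq rexp) :=
  [:: [:: d; Cst 0; a; Cst (-1) * b]%X;
      [:: Cst 0; d; b; a]%X;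
      [:: a; b; e; Cst 0]%X;
      [:: Cst (-1) * b; a; Cst 0; e]%X].

Definition metric : seq (seq rexp) :=
  hermitian ((Cst 1 + Cst (- 2) * T) / (Y * Y))%X
    (Cst (- 2 * k) * W2 * Y * Y)%X (Cst (- 2 * k) * W1 * Y * Y)%X
    (Cst (- (4 / 3) * k) * Y * Y * Y)%X.

Definition inv_metric : seq (seq rexp) :=
  hermitian (Y * Y / S)%X (Cst (- (3 / 2)) * Y * W2 / S)%X
    (Cst (- (3 / 2)) * Y * W1 / S)%X
    (Cst (- (3 / 4)) * (Cst 1 + Cst (- 2) * T) / (Cst k * Y * Y * Y * S))%X.

(** The metric is Kaehler, with Hermitian matrix [H] in the coordinates (z, w),
    so that its Christoffel symbols are the real form of those of the Chern
    connection [dH H^-1].  Below, [zz_z] is the imaginary part of the symbol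
    with lower indices z, z and upper index z, and so on; the suffixes 1 and 2
    denote real and imaginary parts.  The unmentioned parts are zero. *)
Definition christoffel (i : nat) : seq (seq rexp) :=
  let zz_z := ((Cst 1 + Cst (- 2) * T) / (Y * S))%X in
  let zz_w1 := (Cst (- (3 / 2)) * W1 * (Cst 2 + Cst (-1) * T) / (Y * Y * S))%X in
  let zz_w2 := (Cst (- (3 / 2)) * W2 * (Cst 2 + Cst (-1) * T) / (Y * Y * S))%X in
  let zw_z1 := (Cst k * Y * Y * Y * W1 / S)%X in
  let zw_z2 := (Cst (- k) * Y * Y * Y * W2 / S)%X in
  let zw_w := (Cst (- (3 / 2)) / (Y * S))%X in
  let N x := (Cst (-1) * x)%X in
  match i with
  | 0 => [:: [:: Cst 0; zz_z; zz_w1; zz_w2];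
             [:: N zz_z; Cst 0; N zz_w2; zz_w1];
             [:: zw_z1; zw_z2; Cst 0; zw_w];
             [:: N zw_z2; zw_z1; N zw_w; Cst 0]]
  | 1 => [:: [:: N zz_z; Cst 0; N zz_w2; zz_w1];
             [:: Cst 0; N zz_z; N zz_w1; N zz_w2];
             [:: N zw_z2; zw_z1; N zw_w; Cst 0];
             [:: N zw_z1; N zw_z2; Cst 0; N zw_w]]
  | 2 => [:: [:: zw_z1; zw_z2; Cst 0; zw_w];
             [:: N zw_z2; zw_z1; N zw_w; Cst 0];
             [::]; [::]]
  | _ => [:: [:: N zw_z2; zw_z1; N zw_w; Cst 0];
             [:: N zw_z1; N zw_z2; Cst 0; N zw_w];
             [::]; [::]]
  end.

(** The Ricci tensor has eigenvalues [(2 T + 1/2) / (1 + T)^2] on the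
    horizontal planes [Dw = 0] and [(3/2) / (1 + T)^2] on the fibers; [N] is
    the coefficient of [|Dw|^2]. *)
Definition ricci_form : seq (seq rexp) :=
  let N := (Cst (- 2 * k) * Y * Y * Y / (S * S))%X in
  hermitian ((Cst 2 * T + Cst (1 / 2)) / (S * Y * Y)
             + N * Cst (9 / 4) * (W1 * W1 + W2 * W2) / (Y * Y))%X
    (N * Cst (3 / 2) * W2 / Y)%X (N * Cst (3 / 2) * W1 / Y)%X N.

Definition coords (p : 'rV[R]_4) : nat -> R :=
  nth 0 [:: p 0 0; p 0 1; p 0 2; p 0 3].

Definition entry (s : seq (seq rexp)) (i j : nat) : rexp :=
  nth (Cst 0) (nth [::] s i) j.

Definition ev c s i j : R := reval c (entry s i j).

Definition dv c l s i j : R := rdiff c (fun n => (n == l)%:R) (entry s i j).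

Definition mx_of (s : seq (seq rexp)) (p : 'rV[R]_4) : 'M[R]_4 :=
  \matrix_(i, j) ev (coords p) s i j.

Section Identities.
Variables x y u v : R.
Hypotheses (k_neq0 : k != 0) (y_neq0 : y != 0)
  (S_neq0 : 1 + k * y * y * y * (u * u + v * v) != 0).

Let p := nth 0 [:: x; y; u; v].

Ltac by_entries :=
  rewrite /ev /dv ?big_ord_recr ?big_ord0 /=;
  repeat match goal with i : 'I_4 |- _ =>
    case: i => [[|[|[|[|?]]]] ?] // end;
  cbn -[GRing.natmul];
  try ring; field; rewrite ?k_neq0 ?y_neq0 ?S_neq0 //.

Lemma christoffel_sym (i j m : 'I_4) :
  ev p (christoffel i) j m = ev p (christoffel j) i m.
Proof. by_entries. Qed.

Lemma christoffel_metric (i j m : 'I_4) :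
  dv p i metric j m =
  \sum_(l < 4) ev p (christoffel i) j l * ev p metric l m +
  \sum_(l < 4) ev p metric j l * ev p (christoffel i) m l.
Proof. by_entries. Qed.

Lemma metric_inv (i j : 'I_4) :
  \sum_(l < 4) ev p metric i l * ev p inv_metric l j = (i == j)%:R.
Proof. by_entries. Qed.

Lemma ricci_formE (i j : 'I_4) :
  \sum_(l < 4) (dv p l (christoffel i) j l - dv p i (christoffel l) j l +
    (\sum_(m < 4) ev p (christoffel i) j m * ev p (christoffel l) m l
    - \sum_(m < 4) ev p (christoffel l) j m * ev p (christoffel i) m l))
  = ev p ricci_form i j.
Proof. by_entries. Qed.

Lemma scalar_curvatureE :
  \sum_(i < 4) \sum_(j < 4) ev p ricci_form i j * ev p inv_metric j i
  = 4 / (1 + reval p normsq).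
Proof.
(* The trace of a product of two Hermitian matrices in real form. *)
transitivity
  (2 * (ev p ricci_form 0 0 * ev p inv_metric 0 0
      + ev p ricci_form 2 2 * ev p inv_metric 2 2)
   + 4 * (ev p ricci_form 0 2 * ev p inv_metric 0 2
      + ev p ricci_form 1 2 * ev p inv_metric 1 2)).
  rewrite /ricci_form /inv_metric /ev !big_ord_recr !big_ord0 /=.
  by cbn -[reval]; cbn [reval]; ring.
by rewrite /ev; cbn -[GRing.natmul]; field; rewrite ?k_neq0 ?y_neq0 ?S_neq0.
Qed.

(** The curvature of the normal bundle of the zero section is a rotation. *)
Lemma curvature_zero_sectionE (u0 : u = 0) (v0 : v = 0) (i j : 'I_4) :
  (2 <= i)%N -> (2 <= j)%N ->
  dv p 1 (christoffel 0) i j - dv p 0 (christoffel 1) i j +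
    (\sum_(m < 4) ev p (christoffel 0) i m * ev p (christoffel 1) m j
    - \sum_(m < 4) ev p (christoffel 1) i m * ev p (christoffel 0) m j)
  = (3 / 2) / y ^+ 2 * ((i == 2%N :> nat)%:R * (j == 3%N :> nat)%:R
                       - (i == 3%N :> nat)%:R * (j == 2%N :> nat)%:R).
Proof.
rewrite /ev /dv ?big_ord_recr ?big_ord0 /=.
case: i => [[|[|[|[|?]]]] ?] //; case: j => [[|[|[|[|?]]]] ?] // _ _;
cbn -[GRing.natmul]; rewrite u0 v0; rewrite ?(mulr0, mul0r, addr0, add0r, oppr0) ?oppr0.
all: try ring.
all: by field.
Qed.

Lemma metric_sym (i j : 'I_4) : ev p metric i j = ev p metric j i.
Proof. by_entries. Qed.

End Identities.
End Metric.

(** * The function T is invariant *)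

Section Isometry.
Variables (R : realType) (k : R).
Hypothesis k_gt0 : 0 < k.

Local Notation ee i := (delta_mx 0 i : 'rV[R]_4).
Local Notation f := (fun t : R => - k * t).
Local Notation U := (@HxC R).

Lemma open_HxC : open U.
Proof.
have -> : U = (fun p : 'rV[R]_4 => p 0 1) @^-1` [set y : R | 0 < y] by [].
apply: open_comp; last exact: open_gt.
by move=> p _; exact: coord_continuous.
Qed.

Lemma y_neq0 p : U p -> p 0 1 != 0.
Proof. by move=> Up; rewrite gt_eqF. Qed.

Lemma S_gt0 p : U p ->
  0 < 1 + k * p 0 1 * p 0 1 * p 0 1 * (p 0 2 * p 0 2 + p 0 3 * p 0 3).
Proof.
move=> Up; rewrite ltr_pwDl// mulr_ge0//; last first.
  by rewrite addr_ge0// -expr2 sqr_ge0.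
by have y0 := ltW Up; rewrite !mulr_ge0// ltW.
Qed.

Lemma S_neq0 p : U p ->
  1 + k * p 0 1 * p 0 1 * p 0 1 * (p 0 2 * p 0 2 + p 0 3 * p 0 3) != 0.
Proof. by move=> Up; rewrite gt_eqF// S_gt0. Qed.

Lemma gmetricE p : gmetric f p = mx_of (metric k) p.
Proof.
have df : (f^`())%classic (p 0 1 ^+ 3 * (p 0 2 ^+ 2 + p 0 3 ^+ 2)) = - k.
  rewrite derive1E; apply: derive_val.
  have -> : f = - k *: (id : R -> R) by apply/funext.
  by apply: is_derive_eq; exact: mulr1.
apply/matrixP => i j; rewrite [LHS]mxE [RHS]mxE df /ev.
rewrite /coords {df}; move: (p 0 0) (p 0 1) (p 0 2) (p 0 3) => x y u v.
case: i => [[|[|[|[|?]]]] ?] //; case: j => [[|[|[|[|?]]]] ?] //;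
  cbn -[GRing.natmul GRing.exp]; rewrite /= ?[y ^+ 2]expr2;
  try (move: ((y * y)^-1) => c); by field.
Qed.

Lemma is_derive_coords p i n :
  is_derive p (ee i) (fun q => coords q n) (n == i :> nat)%:R.
Proof.
have d a : is_derive p (ee i) (fun q : 'rV[R]_4 => q 0 a) (ee i 0 a).
  by have /is_derive_mx/(_ 0 a) := is_derive_id p (ee i).
case: n => [|[|[|[|n]]]]; rewrite /coords /=.
- by apply: is_derive_eq (d 0) _; rewrite mxE.
- by apply: is_derive_eq (d 1) _; rewrite mxE.
- by apply: is_derive_eq (d 2) _; rewrite mxE.
- by apply: is_derive_eq (d 3) _; rewrite mxE.
have -> : (n.+4 == i) = false by case: i d => [[|[|[|[|?]]]] ?].
by rewrite nth_nil; exact: is_derive_cst.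
Qed.

Lemma differentiable_coords p n : differentiable (fun q : 'rV[R]_4 => coords q n) p.
Proof.
case: n => [|[|[|[|n]]]]; rewrite /coords /=; try exact: differentiable_coord.
by rewrite nth_nil; exact: differentiable_cst.
Qed.

Definition regular s := forall p, U p -> forall i j : 'I_4,
  rdef (coords p) (entry s i j).

Lemma regular_metric : regular (metric k).
Proof.
move=> p Up i j; have y0 := y_neq0 Up.
have yy : p 0 1 * p 0 1 != 0 by rewrite mulf_neq0.
by case: i => [[|[|[|[|?]]]] ?] //; case: j => [[|[|[|[|?]]]] ?] //;
  cbn; do ?split.
Qed.

Lemma regular_christoffel i : regular (christoffel k i).
Proof.
move=> p Up j m; have y0 := y_neq0 Up; have S0 := S_neq0 Up.
have yy : p 0 1 * p 0 1 != 0 by rewrite mulf_neq0.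
have yS : p 0 1 * (1 + k * p 0 1 * p 0 1 * p 0 1 *
    (p 0 2 * p 0 2 + p 0 3 * p 0 3)) != 0 by rewrite mulf_neq0.
have yyS : p 0 1 * p 0 1 * (1 + k * p 0 1 * p 0 1 * p 0 1 *
    (p 0 2 * p 0 2 + p 0 3 * p 0 3)) != 0 by rewrite mulf_neq0.
by case: i => [|[|[|i]]]; case: j => [[|[|[|[|?]]]] ?] //;
  case: m => [[|[|[|[|?]]]] ?] //; cbn; do ?split.
Qed.

Lemma is_derive_mx_of s p l : regular s -> U p ->
  is_derive p (ee l) (mx_of s) (\matrix_(i, j) dv (coords p) l s i j).
Proof.
move=> rs Up; apply/is_derive_mx => i j; rewrite mxE.
rewrite [fun q => _](_ : _ = fun q => reval (coords q) (entry s i j)).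
  exact: (is_derive_reval (F := fun n q => coords q n)
    (is_derive_coords p l) (rs p Up i j)).
by apply/funext => q; rewrite mxE.
Qed.

Lemma differentiable_mx_of s p i j : regular s -> U p ->
  differentiable (fun q => mx_of s q i j) p.
Proof.
move=> rs Up.
rewrite [fun q => _](_ : _ = fun q => reval (coords q) (entry s i j)).
  exact: (differentiable_reval (F := fun n q => coords q n)
    (differentiable_coords p) (rs p Up i j)).
by apply/funext => q; rewrite mxE.
Qed.

Definition conn (i : 'I_4) (p : 'rV[R]_4) : 'M[R]_4 := mx_of (christoffel k i) p.

Let k_neq0 : k != 0. Proof. by rewrite gt_eqF. Qed.

Lemma conn_torsion_free p : U p -> forall i j m, conn i p j m = conn j p i m.
Proof.
move=> Up i j m; rewrite !mxE.
exact: christoffel_sym.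
Qed.

Lemma conn_metric p : U p -> forall i, is_derive p (ee i) (mx_of (metric k))
  (conn i p *m mx_of (metric k) p + mx_of (metric k) p *m (conn i p)^T).
Proof.
move=> Up i; apply: is_derive_eq (is_derive_mx_of i regular_metric Up) _.
apply/matrixP => j m; rewrite !mxE.
have y0 := y_neq0 Up; have S0 := S_neq0 Up.
rewrite [LHS]christoffel_metric//.
by congr (_ + _); apply: eq_bigr => l _; rewrite !mxE.
Qed.

Lemma metric_mx_sym p : (mx_of (metric k) p)^T = mx_of (metric k) p.
Proof. by apply/matrixP => i j; rewrite !mxE; exact: metric_sym. Qed.

Lemma metric_mx_inv p : U p -> mx_of (metric k) p *m mx_of (inv_metric k) p = 1%:M.
Proof.
move=> Up; apply/matrixP => i j; rewrite !mxE.
have y0 := y_neq0 Up; have S0 := S_neq0 Up.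
transitivity (\sum_(l < 4) ev (coords p) (metric k) i l
    * ev (coords p) (inv_metric k) l j); last exact: metric_inv.
by apply: eq_bigr => l _; rewrite !mxE.
Qed.

Lemma metric_mx_unit p : U p -> mx_of (metric k) p \in unitmx.
Proof. by move/metric_mx_inv/mulmx1_unit => []. Qed.

Lemma curv_conn i l p j m : U p -> curv conn i l p j m =
  dv (coords p) l (christoffel k i) j m - dv (coords p) i (christoffel k l) j m +
    (\sum_(n < 4) ev (coords p) (christoffel k i) j n
                  * ev (coords p) (christoffel k l) n m
    - \sum_(n < 4) ev (coords p) (christoffel k l) j n
                  * ev (coords p) (christoffel k i) n m).
Proof.
move=> Up; rewrite /curv.
have [_ ->] := is_derive_mx_of l (regular_christoffel i) Up.
have [_ ->] := is_derive_mx_of i (regular_christoffel l) Up.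
have prod a b : (conn a p *m conn b p) j m =
    \sum_(n < 4) ev (coords p) (christoffel k a) j n
                  * ev (coords p) (christoffel k b) n m.
  by rewrite mxE; apply: eq_bigr => n _; rewrite !mxE.
have BE (A B : 'M[R]_4) : (A - B) j m = A j m - B j m by rewrite !mxE.
have DE (A B : 'M[R]_4) : (A + B) j m = A j m + B j m by rewrite !mxE.
by rewrite DE !BE !prod; congr (_ - _ + _); rewrite mxE.
Qed.

Lemma scalar_curvature p : U p ->
  \tr (ricci conn p *m mx_of (inv_metric k) p)
  = 4 / (1 + reval (coords p) (normsq k)).
Proof.
move=> Up; have y0 := y_neq0 Up; have S0 := S_neq0 Up.
transitivity (\sum_(i < 4) \sum_(j < 4) ev (coords p) (ricci_form k) i j
    * ev (coords p) (inv_metric k) j i); last exact: scalar_curvatureE.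
apply: eq_bigr => i _; rewrite mxE; apply: eq_bigr => j _.
rewrite [mx_of _ _ _ _]mxE; congr (_ * _); rewrite mxE.
apply/esym/(etrans (esym _)); first exact: ricci_formE.
by apply: eq_bigr => l _; rewrite curv_conn.
Qed.

Variable h : 'rV[R]_4 -> 'rV[R]_4.
Hypothesis hisom : metric_isometry (gmetric f) U h.

Lemma isometry_stable p : U p -> U (h p).
Proof. by case: hisom => -[h' [+ _ _ _ _]] _; exact. Qed.

Lemma isometry_Ck n : Ck n U h.
Proof. by case: hisom => -[h' [_ _ + _ _]] _; exact. Qed.

Lemma isometry_differentiable p : U p -> differentiable h p.
Proof. by have [+ _] := isometry_Ck 1; exact. Qed.

Lemma jac_isometry p : U p ->
  jac h p *m mx_of (metric k) (h p) *m (jac h p)^T = mx_of (metric k) p.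
Proof.
move=> Up; have [_ /(_ p Up) iso] := hisom.
have jacE i : 'd h p (ee i) = row i (jac h p).
  rewrite -deriveE; last exact: isometry_differentiable.
  by apply/rowP => a; rewrite [RHS]mxE [RHS]mxE.
have coef (M : 'M[R]_4) i j : M i j = (ee i *m M *m (ee j)^T) 0 0.
  by rewrite -rowE -trmx_delta trmxK -colE !mxE.
apply/matrixP => i j.
rewrite [RHS]coef -!gmetricE -[RHS]/(gram_form _ _ _) -iso !jacE /gram_form.
by rewrite [LHS]coef !rowE trmx_mul !mulmxA.
Qed.

(** [T] is determined by the scalar curvature [4 / (1 + T)]. *)
Theorem normsq_invariant p : U p ->
  reval (coords (h p)) (normsq k) = reval (coords p) (normsq k).
Proof.
move=> Up; have Uhp := isometry_stable Up.
have := scalar_curvature_invariant open_HxC isometry_stable (isometry_Ck 3)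
  (fun q Uq i j => differentiable_mx_of i j regular_metric Uq)
  (fun q Uq i j m => differentiable_mx_of j m (regular_christoffel i) Uq)
  conn_torsion_free conn_metric metric_mx_sym metric_mx_unit jac_isometry Up
  metric_mx_inv.
rewrite !scalar_curvature// => e.
have S1 := S_neq0 Up; have S2 := S_neq0 Uhp.
have : (1 + reval (coords p) (normsq k))^-1 = (1 + reval (coords (h p)) (normsq k))^-1.
  by apply: (mulfI (x := 4)); rewrite ?pnatr_eq0.
by move/invr_inj/addrI.
Qed.

End Isometry.

(** * Isometries are linear on the fibers *)

Section FiberLinearity.
Variables (R : realType) (k : R).
Hypothesis k_gt0 : 0 < k.
Local Notation ee i := (delta_mx 0 i : 'rV[R]_4).
Local Notation f := (fun t : R => - k * t).
Local Notation U := (@HxC R).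
Variable h : 'rV[R]_4 -> 'rV[R]_4.
Hypothesis hisom : metric_isometry (gmetric f) U h.

Definition mkpoint (x y u v : R) : 'rV[R]_4 := \row_j nth 0 [:: x; y; u; v] j.

Definition radial (p : 'rV[R]_4) := mkpoint 0 0 (p 0 2) (p 0 3).

Definition foot (p : 'rV[R]_4) := mkpoint (p 0 0) (p 0 1) 0 0.

Definition dnormsq (p : 'rV[R]_4) : 'rV[R]_4 :=
  \row_i rdiff (coords p) (fun n => (n == i :> nat)%:R) (normsq k).

Lemma radialE p (a : 'I_4) : radial p 0 a = if (a < 2)%N then 0 else p 0 a.
Proof.
rewrite mxE; case: a => [[|[|[|[|?]]]] ?] //=; congr (p _ _); exact: val_inj.
Qed.

(** The radial field is a constant multiple of the gradient of [T]. *)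
Lemma radial_metric p :
  radial p *m mx_of (metric k) p = - (2 / 3) *: dnormsq p.
Proof.
apply/rowP => j; rewrite mxE [RHS]mxE [dnormsq _ _ _]mxE.
under eq_bigr do rewrite [radial _ _ _]mxE [mx_of _ _ _ _]mxE.
rewrite !big_ord_recr big_ord0 /ev /coords /=.
move: (p 0 0) (p 0 1) (p 0 2) (p 0 3) => x y u v.
by case: j => [[|[|[|[|?]]]] ?] //; cbn -[GRing.natmul];
  rewrite !(mul0r, add0r); field.
Qed.

(** The invariance of [T], differentiated. *)
Lemma dnormsq_equivariant p : U p ->
  dnormsq p = dnormsq (h p) *m (jac h p)^T.
Proof.
move=> Up; have Uhp := isometry_stable hisom Up.
have dT q i : U q -> is_derive q (ee i) (fun r => reval (coords r) (normsq k))
    (dnormsq q 0 i).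
  move=> Uq; rewrite mxE.
  by apply: (is_derive_reval (F := fun n q => coords q n)
    (is_derive_coords q i)); cbn; do ?split.
have dTh : differentiable (fun r => reval (coords r) (normsq k)) (h p).
  by apply: (differentiable_reval (F := fun n q => coords q n)
    (differentiable_coords _)); cbn; do ?split.
apply/rowP => i.
have near_eq : \forall q \near p,
    reval (coords q) (normsq k) = ((fun r => reval (coords r) (normsq k)) \o h) q.
  have : nbhs p U by apply: open_nbhs_nbhs; split=> //; exact: open_HxC.
  by apply: filterS => q Uq; exact: esym (normsq_invariant k_gt0 hisom Uq).
have [_ <-] := near_eq_is_derive near_eq (dT p i Up).
have [_ ->] := is_derive_comp_jac (isometry_Ck hisom 3) i Up dTh.
rewrite [RHS]mxE; apply: eq_bigr => a _.
by have [_ ->] := dT (h p) a Uhp; rewrite [_^T _ _]mxE mulrC.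
Qed.

(** [h] preserves both the metric and the differential of [T], hence the
    gradient of [T]. *)
Lemma radial_equivariant p : U p -> radial p *m jac h p = radial (h p).
Proof.
move=> Up; have Uhp := isometry_stable hisom Up.
have Ju : jac h p \in unitmx.
  exact: (jac_unit (metric_mx_unit k_gt0) (jac_isometry hisom) Up).
have Mu : mx_of (metric k) (h p) *m (jac h p)^T \in unitmx.
  by rewrite unitmx_mul metric_mx_unit// unitmx_tr.
apply: (can_inj (mulmxK Mu)); rewrite [RHS]mulmxA radial_metric.
rewrite -scalemxAl -dnormsq_equivariant// -radial_metric.
by rewrite -[in RHS](jac_isometry hisom Up) !mulmxA.
Qed.

Lemma derive_jac v p : U p -> 'D_v h p = v *m jac h p.
Proof.
move=> Up; have dh := isometry_differentiable hisom Up.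
rewrite deriveE// [v in LHS]row_sum_delta linear_sum mulmx_sum_row /=.
apply: eq_bigr => i _; rewrite linearZ /= -deriveE//; congr (_ *: _).
by apply/rowP => a; rewrite [RHS]mxE [RHS]mxE.
Qed.

Lemma is_derive_isometry_line b v s a : U (b + s *: v) ->
  is_derive s 1 (fun t : R => h (b + t *: v) 0 a)
    ((v *m jac h (b + s *: v)) 0 a).
Proof.
move=> Us; rewrite -derive_jac//.
apply: (is_derive_line (f := fun q => h q 0 a)).
have := isometry_differentiable hisom Us => /(diff_derivable (v := v)).
by move=> /derivableP/is_derive_mx; exact.
Qed.

Lemma continuous_jac_line b v s a : U (b + s *: v) ->
  {for s, continuous (fun t : R => 'D_v h (b + t *: v) 0 a)}.
Proof.
move=> Us; have [_ /(_ v)[dd _]] := isometry_Ck hisom 2.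
have := dd _ Us => /(diff_derivable (v := v)) /derivableP/is_derive_mx.
by move=> /(_ 0 a) /is_derive_line/is_derive_continuous.
Qed.

Section Ray.
Variable p : 'rV[R]_4.
Hypothesis Up : U p.

(** Up to the parametrization, the integral curve of the radial field through
    [p], extended up to the zero section. *)
Let ray (s : R) := foot p + s *: radial p.

Let rayE s : ray s = mkpoint (p 0 0) (p 0 1) (s * p 0 2) (s * p 0 3).
Proof.
apply/rowP => j; rewrite !mxE.
by case: j => [[|[|[|[|?]]]] ?] //=; rewrite ?mulr0 ?addr0 ?add0r.
Qed.

Let ray1 : ray 1 = p.
Proof.
rewrite rayE !mul1r; apply/rowP => j; rewrite mxE.
by case: j => [[|[|[|[|?]]]] ?] //=; congr (p _ _); apply/val_inj.
Qed.

Let U_ray s : U (ray s).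
Proof. by rewrite rayE /HxC /= /zcoord /= mxE. Qed.

Let radial_ray s : radial (ray s) = s *: radial p.
Proof.
apply/rowP => j; rewrite rayE !mxE.
by case: j => [[|[|[|[|?]]]] ?] //=; rewrite mulr0.
Qed.

Let c (a : 'I_4) (s : R) : R := h (ray s) 0 a.
Let dc (a : 'I_4) (s : R) : R := (radial p *m jac h (ray s)) 0 a.

Let is_derive_c a (s : R) : is_derive s (1 : R) (c a) (dc a s).
Proof. exact: (is_derive_isometry_line a (U_ray s)). Qed.

(** The image of the ray is again a reparametrized integral curve. *)
Let ray_ode a s : s * dc a s = radial (h (ray s)) 0 a.
Proof.
by rewrite -radial_equivariant// radial_ray -scalemxAl [RHS]mxE.
Qed.

Let dc_eq a (r : R) : (forall s, 0 < s -> dc a s = r) -> dc a 0 = r.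
Proof.
apply: continuous0_cst_pos.
rewrite [dc a](_ : _ = fun s => 'D_(radial p) h (ray s) 0 a).
  exact: (continuous_jac_line (a := a) (U_ray 0)).
by apply/funext => s; rewrite derive_jac.
Qed.

(** By [ray_ode] the base coordinates are constant along the ray. *)
Lemma isometry_base_ray (a : 'I_4) : (a < 2)%N -> h p 0 a = h (foot p) 0 a.
Proof.
move=> a2; have dc0 s : 0 < s -> dc a s = 0.
  move=> s0; have s_neq0 : s != 0 by rewrite gt_eqF.
  by apply: (mulfI s_neq0); rewrite mulr0 ray_ode radialE a2.
have dc00 : dc a 0 = 0 by exact: dc_eq.
rewrite -{1}ray1 -[foot p]addr0 -(scale0r (radial p)) -/(ray 0) -/(c a 1).
apply/esym/(continuous0_cst_pos (f := c a)).
  exact/is_derive_continuous/is_derive_c.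
move=> s s0; apply: (derive0_cst_pos (f := c a)) => // t t0.
by apply: is_derive_eq (is_derive_c a t) (dc0 t t0).
Qed.

(** By [ray_ode] each fiber coordinate [c] satisfies [s c'(s) = c(s)], so
    that [c(s) / s] is constant for [s > 0]; so is [c'(s)], with the same value,
    which by continuity is [c'(0)]. *)
Lemma isometry_fiber_ray (a : 'I_4) : (2 <= a)%N ->
  h p 0 a = (radial p *m jac h (foot p)) 0 a.
Proof.
move=> a2.
have ode s : s * dc a s = c a s.
  by rewrite ray_ode radialE ltnNge a2.
have hom s : 0 < s -> c a s / s = c a 1.
  move=> s0; rewrite -[RHS]divr1.
  apply: (derive0_cst_pos (f := fun s => c a s / s)) => // t t0.
  have t_neq0 : t != 0 by rewrite gt_eqF.
  pose F n := if n is 0%N then c a else id.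
  pose dF n := if n is 0%N then dc a t else 1.
  have dFn n : is_derive t 1 (F n) (dF n).
    by case: n => [|n]; [exact: is_derive_c|exact: is_derive_id].
  have := is_derive_reval (e := (Atm 0 / Atm 1)%X) dFn.
  move=> /(_ (conj I (conj t_neq0 I))) D.
  by apply: is_derive_eq D _; rewrite /= -ode; field.
have dcs s : 0 < s -> dc a s = c a 1.
  move=> s0; rewrite -(hom s s0) -ode; field.
  by rewrite gt_eqF.
have := dc_eq dcs; rewrite /dc /c ray1 => <-.
by rewrite /ray scale0r addr0.
Qed.

End Ray.

End FiberLinearity.

(** * Isometries of the hyperbolic plane *)

Section HalfPlane.
Variable R : realType.
Implicit Types (x y : R).

Lemma grad0_cst (f : R -> R -> R) :
  (forall x y, 0 < y -> is_derive x (1 : R) (f^~ y) 0) ->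
  (forall x y, 0 < y -> is_derive y (1 : R) (f x) 0) ->
  forall x y x' y', 0 < y -> 0 < y' -> f x y = f x' y'.
Proof.
move=> fx fy x y x' y' y0 y'0; transitivity (f x' y).
  by apply: (is_derive_0_is_cst (f := f^~ y)) => z; exact: fx.
by apply: (derive0_cst_pos (f := f x')) => // z; exact: fy.
Qed.

Lemma is_derive_sqr1 (f : R -> R) (x d : R) :
  (\forall t \near x, f t ^+ 2 = 1) -> is_derive x (1 : R) f d -> d = 0.
Proof.
move=> f1 df; have fx1 : f x ^+ 2 = 1 by exact: (nbhs_singleton f1).
have fx0 : f x != 0 by rewrite -sqrf_eq0 fx1 oner_eq0.
have df2 : is_derive x (1 : R) (fun t => f t ^+ 2) (2 * f x * d).
  apply: (is_derive_rexp (e := (Atm 0 * Atm 0)%X)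
    (is_derive_cons df (is_derive_nil _ _))) => [//|t|] /=; ring.
have near1 : \forall t \near x, (cst 1 : R -> R) t = f t ^+ 2.
  by apply: filterS f1 => t ->.
have [_ d0] := near_eq_is_derive near1 (is_derive_cst (1 : R) x (1 : R)).
have [_] := df2; rewrite d0 => /esym/eqP.
by rewrite !mulf_eq0 pnatr_eq0/= (negPf fx0)/= => /eqP.
Qed.

(** A 2x2 matrix with orthogonal rows of equal length is the matrix of a
    complex linear ([e = 1]) or antilinear ([e = -1]) map. *)
Lemma conformal_mx2 (a b c d s : R) : s != 0 ->
  a ^+ 2 + b ^+ 2 = s -> a * c + b * d = 0 -> c ^+ 2 + d ^+ 2 = s ->
  let e := (a * d - b * c) / s in [/\ e ^+ 2 = 1, a = e * d & c = - e * b].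
Proof.
move=> s0 e1 e2 e3 e; have es : e * s = a * d - b * c by rewrite /e divfK.
split; apply: (mulIf s0).
- apply: (mulIf s0); rewrite mul1r.
  transitivity ((e * s) ^+ 2); first by ring.
  transitivity ((a ^+ 2 + b ^+ 2) * (c ^+ 2 + d ^+ 2) - (a * c + b * d) ^+ 2).
    by rewrite es; ring.
  by rewrite e1 e2 e3; ring.
- transitivity (e * s * d); last by ring.
  rewrite es -e3.
  transitivity (a * d ^+ 2 - b * c * d + c * (a * c + b * d)); first by ring.
  by rewrite e2; ring.
- transitivity (- (e * s) * b); last by ring.
  rewrite es -e1.
  transitivity (- (a * d - b * c) * b + a * (a * c + b * d)); first by ring.
  by rewrite e2; ring.
Qed.

(** An isometry [p1 + i p2] of the half-plane is given, with derivatives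
    [a], [b] in direction x and [c], [d] in direction y.  The last four
    hypotheses say that [p2] has the second derivatives imposed by [djacE]. *)
Variables p1 p2 a b c d : R -> R -> R.
Hypotheses
  (p2_gt0 : forall x y, 0 < y -> 0 < p2 x y)
  (dx_p1 : forall x y, 0 < y -> is_derive x (1 : R) (p1^~ y) (a x y))
  (dx_p2 : forall x y, 0 < y -> is_derive x (1 : R) (p2^~ y) (b x y))
  (dy_p1 : forall x y, 0 < y -> is_derive y (1 : R) (p1 x) (c x y))
  (dy_p2 : forall x y, 0 < y -> is_derive y (1 : R) (p2 x) (d x y))
  (conf_xx : forall x y, 0 < y -> a x y ^+ 2 + b x y ^+ 2 = (p2 x y / y) ^+ 2)
  (conf_xy : forall x y, 0 < y -> a x y * c x y + b x y * d x y = 0)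
  (conf_yy : forall x y, 0 < y -> c x y ^+ 2 + d x y ^+ 2 = (p2 x y / y) ^+ 2)
  (dx_a : forall x y, 0 < y -> derivable (a^~ y) x (1 : R))
  (dy_a : forall x y, 0 < y -> derivable (a x) y (1 : R))
  (dx_c : forall x y, 0 < y -> derivable (c^~ y) x (1 : R))
  (dy_c : forall x y, 0 < y -> derivable (c x) y (1 : R))
  (dx_b : forall x y, 0 < y -> is_derive x (1 : R) (b^~ y)
    (d x y / y - (a x y ^+ 2 - b x y ^+ 2) / p2 x y))
  (dy_b : forall x y, 0 < y -> is_derive y (1 : R) (b x)
    (- (b x y / y) - (a x y * c x y - b x y * d x y) / p2 x y))
  (dx_d : forall x y, 0 < y -> is_derive x (1 : R) (d^~ y)
    (- (b x y / y) - (a x y * c x y - b x y * d x y) / p2 x y))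
  (dy_d : forall x y, 0 < y -> is_derive y (1 : R) (d x)
    (- (d x y / y) - (c x y ^+ 2 - d x y ^+ 2) / p2 x y)).

Let sgn x y := (a x y * d x y - b x y * c x y) / (p2 x y / y) ^+ 2.

Let scale_neq0 x y : 0 < y -> (p2 x y / y) ^+ 2 != 0.
Proof. by move=> y0; rewrite gt_eqF// exprn_gt0// divr_gt0// p2_gt0. Qed.

Let p2_neq0 x y : 0 < y -> p2 x y != 0.
Proof. by move=> y0; rewrite gt_eqF// p2_gt0. Qed.

Let sgnP x y : 0 < y -> [/\ sgn x y ^+ 2 = 1, a x y = sgn x y * d x y
  & c x y = - sgn x y * b x y].
Proof.
move=> y0; exact: (conformal_mx2 (scale_neq0 x y0) (conf_xx _ y0)
  (conf_xy _ y0) (conf_yy _ y0)).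
Qed.

Let sgn_expr : rexp R :=
  ((Atm 0 * Atm 3 + Cst (-1) * Atm 1 * Atm 2) /
   ((Atm 4 / Atm 5) * (Atm 4 / Atm 5)))%X.

(** The square of [sgn] is constant and [sgn] does not vanish. *)
Let sgn_cst x y x' y' : 0 < y -> 0 < y' -> sgn x y = sgn x' y'.
Proof.
apply: grad0_cst => {x y x' y'} x y y0.
  have D := is_derive_cons (derivableP (@dx_a x y y0)) (is_derive_cons (@dx_b x y y0)
    (is_derive_cons (derivableP (@dx_c x y y0)) (is_derive_cons (@dx_d x y y0)
    (is_derive_cons (@dx_p2 x y y0) (is_derive_cons (is_derive_cst y x (1 : R))
      (is_derive_nil _ _)))))).
  have near1 : \forall t \near x, sgn t y ^+ 2 = 1.
    by near=> t; have [] := sgnP t y0.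
  have [e dS] : exists e, is_derive x (1 : R) (sgn^~ y) e.
    eexists; apply: (is_derive_rexp (e := sgn_expr) D); last by [].
      by cbn; rewrite -expr2 scale_neq0// gt_eqF.
    by move=> t; rewrite /sgn /=; congr (_ / _); ring.
  by have e0 := is_derive_sqr1 near1 dS; rewrite e0 in dS.
have D := is_derive_cons (derivableP (@dy_a x y y0)) (is_derive_cons (@dy_b x y y0)
    (is_derive_cons (derivableP (@dy_c x y y0)) (is_derive_cons (@dy_d x y y0)
    (is_derive_cons (@dy_p2 x y y0) (is_derive_cons (is_derive_id y (1 : R))
      (is_derive_nil _ _)))))).
have near1 : \forall t \near y, sgn x t ^+ 2 = 1.
  near=> t; have t0 : 0 < t by near: t; exact: lt_nbhsr.
  by have [] := sgnP x t0.
have [e dS] : exists e, is_derive y (1 : R) (sgn x) e.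
  eexists; apply: (is_derive_rexp (e := sgn_expr) D); last by [].
    by cbn; rewrite -expr2 scale_neq0// gt_eqF.
  by move=> t; rewrite /sgn /=; congr (_ / _); ring.
by have e0 := is_derive_sqr1 near1 dS; rewrite e0 in dS.
Unshelve. all: by end_near. Qed.


Let b_neg x y : 0 < y -> a x y * c x y = - (b x y * d x y).
Proof. by move=> y0; apply/eqP; rewrite -addr_eq0 conf_xy. Qed.

Let conf_cols x y : 0 < y -> b x y ^+ 2 + d x y ^+ 2 = (p2 x y / y) ^+ 2.
Proof.
move=> y0; rewrite -(conf_yy x y0); have [e1 _ ->] := sgnP x y0.
by rewrite mulNr sqrrN exprMn e1 mul1r.
Qed.

(** The function [1 / p2] has Hessian [(1 / p2) g], where [g] is the hyperbolic
    metric, like the functions [1/y], [x/y] and [(x^2 + y^2)/y].  In terms of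
    [Q] this says that [Q_xx = Q_yy = Q_y / y] and [Q_xy = 0]; [S] is
    [Q_y / y]. *)
Let Q x y := y / p2 x y.
Let Qx x y := - y * b x y / p2 x y ^+ 2.
Let S x y := (y * p2 x y)^-1 - d x y / p2 x y ^+ 2.

Let dx_Q x y : 0 < y -> is_derive x (1 : R) (Q^~ y) (Qx x y).
Proof.
move=> y0; have n0 := p2_neq0 x y0; apply: (is_derive_rexp (e := (Cst y / Atm 0)%X)
  (is_derive_cons (@dx_p2 x y y0) (is_derive_nil _ _))); cbn=> //=.
by rewrite /Qx; field.
Qed.

Let dy_Q x y : 0 < y -> is_derive y (1 : R) (Q x) (y * S x y).
Proof.
move=> y0; have n0 := p2_neq0 x y0; have n1 : y != 0 by rewrite gt_eqF.
apply: (is_derive_rexp (e := (Atm 1 / Atm 0)%X)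
  (is_derive_cons (@dy_p2 x y y0) (is_derive_cons (is_derive_id y (1 : R))
    (is_derive_nil _ _)))); cbn=> //=.
by rewrite /S; field; rewrite n0 n1.
Qed.

Let dx_S x y : 0 < y -> is_derive x (1 : R) (S^~ y) 0.
Proof.
move=> y0; have n0 := p2_neq0 x y0; have n1 : y != 0 by rewrite gt_eqF.
apply: (is_derive_rexp (e := (Inv (Cst y * Atm 0)
    + Cst (-1) * Atm 1 / (Atm 0 * Atm 0))%X)
  (is_derive_cons (@dx_p2 x y y0) (is_derive_cons (@dx_d x y y0)
    (is_derive_nil _ _)))); cbn=> /=.
- by rewrite !mulf_neq0.
- by move=> t; rewrite /S expr2 mulN1r mulNr.
- by rewrite (b_neg x y0); field; rewrite n0 n1.
Qed.

Let dy_S x y : 0 < y -> is_derive y (1 : R) (S x) 0.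
Proof.
move=> y0; have n0 := p2_neq0 x y0; have n1 : y != 0 by rewrite gt_eqF.
apply: (is_derive_rexp (e := (Inv (Atm 2 * Atm 0)
    + Cst (-1) * Atm 1 / (Atm 0 * Atm 0))%X)
  (is_derive_cons (@dy_p2 x y y0) (is_derive_cons (@dy_d x y y0)
    (is_derive_cons (is_derive_id y (1 : R)) (is_derive_nil _ _))))); cbn=> /=.
- by rewrite !mulf_neq0.
- by move=> t; rewrite /S expr2 mulN1r mulNr.
- have -> : c x y ^+ 2 = (p2 x y / y) ^+ 2 - d x y ^+ 2.
    by rewrite -(conf_yy x y0) addrK.
  by field; rewrite n0 n1.
Qed.

Let dx_Qx x y : 0 < y -> is_derive x (1 : R) (Qx^~ y) (S x y).
Proof.
move=> y0; have n0 := p2_neq0 x y0; have n1 : y != 0 by rewrite gt_eqF.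
apply: (is_derive_rexp (e := (Cst (- y) * Atm 1 / (Atm 0 * Atm 0))%X)
  (is_derive_cons (@dx_p2 x y y0) (is_derive_cons (@dx_b x y y0)
    (is_derive_nil _ _)))); cbn=> /=.
- by rewrite !mulf_neq0.
- by move=> t; rewrite /Qx expr2.
- have -> : a x y ^+ 2 = (p2 x y / y) ^+ 2 - b x y ^+ 2.
    by rewrite -(conf_xx x y0) addrK.
  by rewrite /S; field; rewrite n0 n1.
Qed.

Let dy_Qx x y : 0 < y -> is_derive y (1 : R) (Qx x) 0.
Proof.
move=> y0; have n0 := p2_neq0 x y0; have n1 : y != 0 by rewrite gt_eqF.
apply: (is_derive_rexp (e := (Cst (- 1) * Atm 2 * Atm 1 / (Atm 0 * Atm 0))%X)
  (is_derive_cons (@dy_p2 x y y0) (is_derive_cons (@dy_b x y y0)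
    (is_derive_cons (is_derive_id y (1 : R)) (is_derive_nil _ _))))); cbn=> /=.
- by rewrite !mulf_neq0.
- by move=> t; rewrite /Qx expr2 mulN1r.
- by rewrite (b_neg x y0); field; rewrite n0 n1.
Qed.

(** The differential of [p1 + i p2] is conformal with factor [p2 / y]. *)
Let Q_eikonal x y : 0 < y ->
  Qx x y ^+ 2 + (y * S x y) ^+ 2 = 2 * Q x y * S x y.
Proof.
move=> y0; have n0 := p2_neq0 x y0; have n1 : y != 0 by rewrite gt_eqF.
have b2 : b x y ^+ 2 = (p2 x y / y) ^+ 2 - d x y ^+ 2.
  by rewrite -(conf_cols x y0) addrK.
rewrite /Qx /S /Q.
transitivity (y ^+ 2 * b x y ^+ 2 / p2 x y ^+ 4
  + (1 / p2 x y - y * d x y / p2 x y ^+ 2) ^+ 2); first by field; rewrite n0 n1.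
by rewrite b2; field; rewrite n0 n1.
Qed.

(** [S] is constant, hence so are [Qx - S x] and then
    [Q - (S/2) (x^2 + y^2) - (Qx - S x) x]; the discriminant comes from
    [Q_eikonal]. *)
Let Q_quadratic : exists q2 q1 q0 : R,
  [/\ q1 ^+ 2 = 4 * q2 * q0, 0 <= q2 &
      forall x y, 0 < y -> [/\ Q x y = q2 * (x ^+ 2 + y ^+ 2) + q1 * x + q0,
        Qx x y = 2 * q2 * x + q1 & S x y = 2 * q2]].
Proof.
pose q2 := S 0 1 / 2.
have SE x y : 0 < y -> S x y = 2 * q2.
  by move=> y0; rewrite (grad0_cst dx_S dy_S x 0 y0 (@ltr01 R)) /q2; field.
pose q1 := Qx 0 1.
have QxE x y : 0 < y -> Qx x y = 2 * q2 * x + q1.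
  move=> y0; apply/eqP; rewrite addrC -subr_eq; apply/eqP.
  have -> : q1 = Qx 0 1 - 2 * q2 * 0 by rewrite mulr0 subr0.
  apply: (grad0_cst (f := fun x y => Qx x y - 2 * q2 * x)) => // {}x {}y {}y0.
    apply: (is_derive_rexp (e := (Atm 0 + Cst (- (2 * q2)) * Atm 1)%X)
      (is_derive_cons (@dx_Qx x y y0) (is_derive_cons (is_derive_id x (1 : R))
        (is_derive_nil _ _)))); cbn=> //=.
      by move=> t; rewrite mulNr.
    by rewrite SE//; ring.
  apply: (is_derive_rexp (e := (Atm 0 + Cst (- (2 * q2) * x))%X)
      (is_derive_cons (@dy_Qx x y y0) (is_derive_nil _ _))); cbn=> //=.
    by move=> t; rewrite mulNr.
  by rewrite addr0.
pose q0 := Q 0 1 - q2.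
have QE x y : 0 < y -> Q x y = q2 * (x ^+ 2 + y ^+ 2) + q1 * x + q0.
  move=> y0; apply/eqP; rewrite addrC -subr_eq; apply/eqP.
  have -> : q0 = Q 0 1 - (q2 * (0 ^+ 2 + 1 ^+ 2) + q1 * 0) by rewrite /q0; ring.
  apply: (grad0_cst (f := fun x y => Q x y - (q2 * (x ^+ 2 + y ^+ 2) + q1 * x)))
    => // {}x {}y {}y0.
    apply: (is_derive_rexp (e := (Atm 0 + Cst (- 1) * (Cst q2 *
        (Atm 1 * Atm 1 + Cst (y ^+ 2)) + Cst q1 * Atm 1))%X)
      (is_derive_cons (@dx_Q x y y0) (is_derive_cons (is_derive_id x (1 : R))
        (is_derive_nil _ _)))); cbn=> //=.
      by move=> t; ring.
    by rewrite QxE//; ring.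
  apply: (is_derive_rexp (e := (Atm 0 + Cst (- 1) * (Cst q2 *
        (Cst (x ^+ 2) + Atm 1 * Atm 1) + Cst (q1 * x)))%X)
      (is_derive_cons (@dy_Q x y y0) (is_derive_cons (is_derive_id y (1 : R))
        (is_derive_nil _ _)))); cbn=> //=.
    by move=> t; ring.
  by rewrite SE//; ring.
exists q2, q1, q0; split; last by move=> x y y0; split; auto.
- have := Q_eikonal 0 (@ltr01 R); rewrite SE// QxE// QE// => e.
  by move: e; rewrite !expr2; lra.
- have Q0 : 0 < Q 0 1 by rewrite divr_gt0// p2_gt0.
  have := Q_eikonal 0 (@ltr01 R); rewrite SE// => e.
  have : 0 <= Q 0 1 * q2.
    have -> : Q 0 1 * q2 = (Qx 0 1 ^+ 2 + (1 * (2 * q2)) ^+ 2) / 4.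
      by rewrite e; field.
    by rewrite divr_ge0// addr_ge0// sqr_ge0.
  by rewrite pmulr_rge0.
Qed.

Let D g dl e x y : R := (g * (e * x) + dl) ^+ 2 + (g * y) ^+ 2.

(** A nonnegative quadratic polynomial with zero discriminant is a square;
    here [Q] is [|g zeta + dl|^2] with [zeta = e x + i y]. *)
Let Q_denominator e : e ^+ 2 = 1 -> exists g dl : R, forall x y, 0 < y ->
  [/\ Q x y = D g dl e x y, Qx x y = 2 * g * e * (g * (e * x) + dl)
    & S x y = 2 * g ^+ 2].
Proof.
move=> e1; have [q2 [q1 [q0 [disc q2_ge0 QE]]]] := Q_quadratic.
(* In the affine case [phi] is [zeta / q0] up to a translation. *)
have [q20|q2_neq0] := eqVneq q2 0.
  have q10 : q1 = 0.
    by apply/eqP; rewrite -sqrf_eq0 disc q20; apply/eqP; ring.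
  have q0_gt0 : 0 < q0.
    have [<-] : [/\ Q 0 1 = q0, True & True].
      by split=> //; have [-> _ _] := QE 0 1 ltr01; rewrite q20 q10; ring.
    by rewrite divr_gt0// p2_gt0.
  exists 0, (Num.sqrt q0) => x y y0; have [-> -> ->] := QE x y y0.
  rewrite /D q20 q10 !mul0r !add0r expr0n /= addr0 sqr_sqrtr ?ltW//.
  by split; ring.
have q2_gt0 : 0 < q2 by rewrite lt_neqAle eq_sym q2_neq0.
pose g := Num.sqrt q2; have g2 : g ^+ 2 = q2 by rewrite sqr_sqrtr.
have g_neq0 : g != 0 by rewrite gt_eqF// sqrtr_gt0.
exists g, (e * q1 / (2 * g)) => x y y0; have [-> -> ->] := QE x y y0.
have q0E : q0 = q1 ^+ 2 / (4 * q2) by rewrite disc; field.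
rewrite /D q0E -g2; split=> //.
  transitivity (g ^+ 2 * (e ^+ 2 * x ^+ 2 + y ^+ 2) + e ^+ 2 * q1 * x
      + e ^+ 2 * q1 ^+ 2 / (4 * g ^+ 2)); last by field.
  by rewrite e1 !mul1r.
transitivity (2 * g ^+ 2 * (e ^+ 2 * x) + e ^+ 2 * q1); last by field.
by rewrite e1 !mul1r.
Qed.

(** Once the imaginary part [p2] is known, the real part is determined up to a
    constant by the Cauchy-Riemann equations, or their conjugates.  The constant
    [tau] is absorbed by the translation [zeta |-> zeta + tau]. *)
Theorem half_plane_isometry : exists al be g dl e : R,
  [/\ al * dl - be * g = 1, e = 1 \/ e = -1 & forall x y, 0 < y ->
    let X := e * x in let m := g * X + dl in let N := m ^+ 2 + (g * y) ^+ 2 in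
    [/\ 0 < N, p1 x y = ((al * X + be) * m + al * g * y ^+ 2) / N,
        p2 x y = y / N, a x y = e * d x y /\ c x y = - e * b x y &
        b x y = - (2 * g * e * m * y) / N ^+ 2
          /\ d x y = (m ^+ 2 - (g * y) ^+ 2) / N ^+ 2]].
Proof.
pose e := sgn 0 1.
have [e1 _ _] := sgnP 0 (@ltr01 R); rewrite -/e in e1.
have e_pm : e = 1 \/ e = -1.
  by move/eqP: e1; rewrite sqrf_eq1 => /orP[] /eqP ->; [left|right].
have acE x y : 0 < y -> a x y = e * d x y /\ c x y = - e * b x y.
  by move=> y0; rewrite /e (sgn_cst 0 x ltr01 y0); have [] := sgnP x y0.
have [g [dl QE]] := Q_denominator e1.
have N_gt0 x y : 0 < y -> 0 < D g dl e x y.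
  by move=> y0; have [<- _ _] := QE x y y0; rewrite divr_gt0// p2_gt0.
have p2E x y : 0 < y -> p2 x y = y / D g dl e x y.
  move=> y0; have [<- _ _] := QE x y y0; have := p2_neq0 x y0.
  by move=> n0; rewrite /Q; field; rewrite n0 gt_eqF.
have bdE x y : 0 < y -> b x y = - (2 * g * e * (g * (e * x) + dl) * y)
      / D g dl e x y ^+ 2
    /\ d x y = ((g * (e * x) + dl) ^+ 2 - (g * y) ^+ 2) / D g dl e x y ^+ 2.
  move=> y0; have [_ QxE SE] := QE x y y0; have n0 := p2_neq0 x y0.
  have n1 : y != 0 by rewrite gt_eqF.
  have n2 : D g dl e x y != 0 by rewrite gt_eqF// N_gt0.
  split.
    have -> : b x y = - Qx x y * p2 x y ^+ 2 / y.
      by rewrite /Qx; field; rewrite n0 n1.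
    by rewrite QxE p2E//; field; rewrite n1 n2.
  have -> : d x y = p2 x y / y - S x y * p2 x y ^+ 2.
    by rewrite /S; field; rewrite n0 n1.
  rewrite SE p2E//.
  have -> : (g * (e * x) + dl) ^+ 2 = D g dl e x y - (g * y) ^+ 2.
    by rewrite /D addrK.
  by field; rewrite n1 n2.
have gd_gt0 : 0 < g ^+ 2 + dl ^+ 2.
  have := N_gt0 0 1 ltr01; rewrite /D mulr0 mulr0 add0r mulr1 addrC.
  exact.
(* [psi] is the real part of a Moebius map with denominator [g zeta + dl]. *)
pose n := g ^+ 2 + dl ^+ 2; have n_neq0 : n != 0 by rewrite gt_eqF.
pose psi x y : R := ((dl / n * (e * x) - g / n) * (g * (e * x) + dl)
  + dl / n * g * y ^+ 2) / D g dl e x y.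
pose tau := p1 0 1 - psi 0 1.
have p1E x y : 0 < y -> p1 x y - psi x y = tau.
  move=> y0; apply: (grad0_cst (f := fun x y => p1 x y - psi x y)) => //
    {}x {}y {}y0; have n2 : D g dl e x y != 0 by rewrite gt_eqF// N_gt0.
  - have [aE _] := acE x y y0; have [_ dE] := bdE x y y0.
    apply: (is_derive_rexp (e := (Atm 0 + Cst (- 1) * (
        ((Cst (dl / n) * (Cst e * Atm 1) + Cst (- (g / n)))
          * (Cst g * (Cst e * Atm 1) + Cst dl) + Cst (dl / n * g * y ^+ 2))
        / ((Cst g * (Cst e * Atm 1) + Cst dl) * (Cst g * (Cst e * Atm 1)
          + Cst dl) + Cst ((g * y) ^+ 2))))%X)
      (is_derive_cons (@dx_p1 x y y0) (is_derive_cons (is_derive_id x (1 : R))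
        (is_derive_nil _ _)))); cbn=> /=.
    + by rewrite -expr2 -/(D g dl e x y) n2.
    + by move=> t; rewrite /psi /D mulN1r; congr (_ - _ / _); ring.
    rewrite aE dE; rewrite /D /n in n2 n_neq0 *.
    by case: e_pm n2 => ->; rewrite ?mul1r ?mulN1r => n2; field;
      rewrite -?expr2 n_neq0 n2.
  - have [_ cE] := acE x y y0; have [bE _] := bdE x y y0.
    apply: (is_derive_rexp (e := (Atm 0 + Cst (- 1) * (
        (Cst ((dl / n * (e * x) - g / n) * (g * (e * x) + dl))
          + Cst (dl / n * g) * Atm 1 * Atm 1)
        / (Cst ((g * (e * x) + dl) ^+ 2)
           + (Cst g * Atm 1) * (Cst g * Atm 1))))%X)
      (is_derive_cons (@dy_p1 x y y0) (is_derive_cons (is_derive_id y (1 : R))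
        (is_derive_nil _ _)))); cbn=> /=.
    + by rewrite -[X in _ + X]expr2 -/(D g dl e x y) n2.
    + by move=> t; rewrite /psi /D mulN1r; congr (_ - _ / _); ring.
    rewrite cE bE; rewrite /D /n in n2 n_neq0 *.
    by case: e_pm n2 => ->; rewrite ?mul1r ?mulN1r => n2; field;
      rewrite -?expr2 n_neq0 n2.
exists (dl / n + tau * g), (- (g / n) + tau * dl), g, dl, e; split=> //.
  by rewrite /n in n_neq0 *; field.
move=> x y y0 X m N.
have n2 : D g dl e x y != 0 by rewrite gt_eqF// N_gt0.
split; [exact: N_gt0| |exact: p2E|exact: acE|exact: bdE].
have -> : p1 x y = psi x y + tau by rewrite -(p1E x y y0) addrC subrK.
have -> : psi x y + tau = (psi x y * N + tau * N) / N.
  by rewrite -mulrDl mulfK.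
congr (_ / _); rewrite /psi divfK//; rewrite /N /m /X; ring.
Qed.

End HalfPlane.

(** [r1 + i r2] is the quotient of [c1 + i c2] by [q1 + i q2]. *)
Lemma complex_quotient (F : fieldType) (c1 c2 q1 q2 n : F) : n != 0 ->
  q1 ^+ 2 + q2 ^+ 2 = n ->
  let r1 := (c1 * q1 + c2 * q2) / n in let r2 := (c2 * q1 - c1 * q2) / n in
  [/\ r1 ^+ 2 + r2 ^+ 2 = (c1 ^+ 2 + c2 ^+ 2) / n,
      r1 * q1 - r2 * q2 = c1 & r1 * q2 + r2 * q1 = c2].
Proof.
move=> n0 qn r1 r2; rewrite -qn in n0 r1 r2 *.
by split; rewrite /r1 /r2; field.
Qed.

Section FiberFactor.
Variable R : realType.
Implicit Types (x y : R).
Variables (g dl e : R) (p2 b d c1 c2 : R -> R -> R).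
Hypothesis e_pm : e = 1 \/ e = -1.

Local Notation m x := (g * (e * x) + dl).
Local Notation N x y := (m x ^+ 2 + (g * y) ^+ 2).
Local Notation cube1 x y := (m x ^+ 3 - 3 * m x * (g * y) ^+ 2).
Local Notation cube2 x y := (3 * m x ^+ 2 * (g * y) - (g * y) ^+ 3).

Hypotheses (N_gt0 : forall x y, 0 < y -> 0 < N x y)
  (p2E : forall x y, 0 < y -> p2 x y = y / N x y)
  (bE : forall x y, 0 < y -> b x y = - (2 * g * e * m x * y) / N x y ^+ 2)
  (dE : forall x y, 0 < y -> d x y = (m x ^+ 2 - (g * y) ^+ 2) / N x y ^+ 2)
  (dx_c1 : forall x y, 0 < y -> is_derive x (1 : R) (c1^~ y)
    (3 / 2 / y * e * c2 x y
     - 3 / 2 / p2 x y * (b x y * c1 x y + e * d x y * c2 x y)))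
  (dx_c2 : forall x y, 0 < y -> is_derive x (1 : R) (c2^~ y)
    (- (3 / 2 / y * e * c1 x y)
     - 3 / 2 / p2 x y * (b x y * c2 x y - e * d x y * c1 x y)))
  (dy_c1 : forall x y, 0 < y -> is_derive y (1 : R) (c1 x)
    (3 / 2 / y * c1 x y
     - 3 / 2 / p2 x y * (d x y * c1 x y - e * b x y * c2 x y)))
  (dy_c2 : forall x y, 0 < y -> is_derive y (1 : R) (c2 x)
    (3 / 2 / y * c2 x y
     - 3 / 2 / p2 x y * (d x y * c2 x y + e * b x y * c1 x y)))
  (norm_c : forall x y, 0 < y -> c1 x y ^+ 2 + c2 x y ^+ 2 = N x y ^+ 3).

(** [r1 + i r2] is the quotient of [c1 + i c2] by the cube of
    [j = g zeta + dl], where [zeta = e x + i y], [m] is the real part of [j]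
    and [N] its squared modulus. *)
Let r1 x y : R := (c1 x y * cube1 x y + c2 x y * cube2 x y) / N x y ^+ 3.
Let r2 x y : R := (c2 x y * cube1 x y - c1 x y * cube2 x y) / N x y ^+ 3.

Let mX : rexp R := (Cst g * (Cst e * Atm 2) + Cst dl)%X.
Let gY : rexp R := (Cst g * Atm 3)%X.
Let Nexp := (mX * mX + gY * gY)%X.
Let cube1_exp := (mX * mX * mX + Cst (- 3) * mX * (gY * gY))%X.
Let cube2_exp := (Cst 3 * mX * mX * gY + Cst (-1) * gY * gY * gY)%X.
Let r1_exp :=
  ((Atm 0 * cube1_exp + Atm 1 * cube2_exp) / (Nexp * Nexp * Nexp))%X.
Let r2_exp :=
  ((Atm 1 * cube1_exp + Cst (-1) * Atm 0 * cube2_exp) / (Nexp * Nexp * Nexp))%X.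

Let envx x y (y0 : 0 < y) := is_derive_cons (@dx_c1 x y y0)
  (is_derive_cons (@dx_c2 x y y0) (is_derive_cons (is_derive_id x (1 : R))
  (is_derive_cons (is_derive_cst y x (1 : R)) (is_derive_nil _ _)))).
Let envy x y (y0 : 0 < y) := is_derive_cons (@dy_c1 x y y0)
  (is_derive_cons (@dy_c2 x y y0) (is_derive_cons (is_derive_cst x y (1 : R))
  (is_derive_cons (is_derive_id y (1 : R)) (is_derive_nil _ _)))).

Ltac factor_const ex env N0 n1 :=
  apply: (is_derive_rexp (e := ex) env); cbn=> /=;
  [ by rewrite -!expr2 !mulf_neq0
  | by move=> t; rewrite /r1 /r2; congr (_ / _); ring
  | rewrite p2E// bE// dE//;
    case: e_pm N0 => ->; rewrite ?mul1r ?mulN1r => N0; field;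
    rewrite -?expr2 N0 n1 // ].

Let dx_r1 x y : 0 < y -> is_derive x (1 : R) (r1^~ y) 0.
Proof.
move=> y0; have N0 : N x y != 0 by rewrite gt_eqF// N_gt0.
have n1 : y != 0 by rewrite gt_eqF.
factor_const r1_exp (@envx x y y0) N0 n1.
Qed.

Let dx_r2 x y : 0 < y -> is_derive x (1 : R) (r2^~ y) 0.
Proof.
move=> y0; have N0 : N x y != 0 by rewrite gt_eqF// N_gt0.
have n1 : y != 0 by rewrite gt_eqF.
factor_const r2_exp (@envx x y y0) N0 n1.
Qed.

Let dy_r1 x y : 0 < y -> is_derive y (1 : R) (r1 x) 0.
Proof.
move=> y0; have N0 : N x y != 0 by rewrite gt_eqF// N_gt0.
have n1 : y != 0 by rewrite gt_eqF.
factor_const r1_exp (@envy x y y0) N0 n1.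
Qed.

Let dy_r2 x y : 0 < y -> is_derive y (1 : R) (r2 x) 0.
Proof.
move=> y0; have N0 : N x y != 0 by rewrite gt_eqF// N_gt0.
have n1 : y != 0 by rewrite gt_eqF.
factor_const r2_exp (@envy x y y0) N0 n1.
Qed.

(** The four differential equations say that [c1 + i c2] and [j^3] have the
    same logarithmic derivative. *)
Lemma fiber_factor : exists t1 t2 : R, t1 ^+ 2 + t2 ^+ 2 = 1 /\
  forall x y, 0 < y -> c1 x y = t1 * cube1 x y - t2 * cube2 x y
    /\ c2 x y = t1 * cube2 x y + t2 * cube1 x y.
Proof.
have cubeN x y : cube1 x y ^+ 2 + cube2 x y ^+ 2 = N x y ^+ 3 by ring.
have N3 x y : 0 < y -> N x y ^+ 3 != 0.
  by move=> y0; rewrite expf_neq0// gt_eqF// N_gt0.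
exists (r1 0 1), (r2 0 1); split.
  have [-> _ _] := complex_quotient (c1 0 1) (c2 0 1) (N3 0 1 ltr01) (cubeN 0 1).
  by rewrite norm_c// mulfV// N3.
move=> x y y0; rewrite -(grad0_cst dx_r1 dy_r1 x 0 y0 ltr01).
rewrite -(grad0_cst dx_r2 dy_r2 x 0 y0 ltr01).
by have [_ -> ->] := complex_quotient (c1 x y) (c2 x y) (N3 x y y0) (cubeN x y).
Qed.

End FiberFactor.

(** * The isometry along the zero section *)

Section ZeroSection.
Variables (R : realType) (k : R).
Hypothesis k_gt0 : 0 < k.
Local Notation ee i := (delta_mx 0 i : 'rV[R]_4).
Local Notation f := (fun t : R => - k * t).
Local Notation U := (@HxC R).
Variable h : 'rV[R]_4 -> 'rV[R]_4.
Hypothesis hisom : metric_isometry (gmetric f) U h.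
Implicit Types (x y : R).

Let k_neq0 : k != 0. Proof. by rewrite gt_eqF. Qed.

Definition zpt x y : 'rV[R]_4 := mkpoint x y 0 0.

Let J x y := jac h (zpt x y).
Let p1 x y := h (zpt x y) 0 0.
Let p2 x y := h (zpt x y) 0 1.

Lemma HxC_zpt x y : 0 < y -> U (zpt x y).
Proof. by move=> y0; rewrite /HxC /= mxE. Qed.

Lemma foot_zpt x y : foot (zpt x y) = zpt x y.
Proof. by rewrite /foot !mxE. Qed.

Lemma sum_ord4 (V : nmodType) (F : 'I_4 -> V) :
  \sum_(i < 4) F i = F 0 + F 1 + F 2 + F 3.
Proof.
rewrite !big_ord_recr big_ord0 /= add0r.
by congr (F _ + F _ + F _ + F _); apply: val_inj.
Qed.

Lemma isometry_zpt x y : 0 < y -> h (zpt x y) = zpt (p1 x y) (p2 x y).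
Proof.
move=> y0; have Uz := HxC_zpt x y0.
have fib (a : 'I_4) : (2 <= a)%N -> h (zpt x y) 0 a = 0.
  move=> a2; rewrite (isometry_fiber_ray k_gt0 hisom Uz a2).
  rewrite mxE big1// => i _; rewrite mxE.
  by case: i => [[|[|[|[|?]]]] ?] //=; rewrite ?mxE /= mul0r.
apply/rowP => a; rewrite [RHS]mxE.
case: a => [[|[|[|[|?]]]] a4] //=; last 2 first.
- exact: fib.
- exact: fib.
- by congr (h _ _ _); apply: val_inj.
- by congr (h _ _ _); apply: val_inj.
Qed.

Lemma p2_gt0 x y : 0 < y -> 0 < p2 x y.
Proof. by move=> y0; exact: (isometry_stable hisom (HxC_zpt x y0)). Qed.

Lemma zpt_linex y x s : zpt (x + s) y = zpt x y + s *: ee 0.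
Proof.
apply/rowP => a; rewrite !mxE.
by case: a => [[|[|[|[|?]]]] ?] //=; rewrite ?mulr1 ?mulr0 ?addr0.
Qed.

Lemma zpt_liney x y s : zpt x (y + s) = zpt x y + s *: ee 1.
Proof.
apply/rowP => a; rewrite !mxE.
by case: a => [[|[|[|[|?]]]] ?] //=; rewrite ?mulr1 ?mulr0 ?addr0.
Qed.

Lemma is_derive_zptx (F : 'rV[R]_4 -> R) x y D :
  is_derive (zpt x y) (ee 0) F D -> is_derive x (1 : R) (fun t => F (zpt t y)) D.
Proof.
move=> dF; have -> : (fun t => F (zpt t y)) = fun t => F (zpt 0 y + t *: ee 0).
  by apply/funext => t; rewrite -zpt_linex add0r.
by apply: is_derive_line; rewrite -zpt_linex add0r.
Qed.

Lemma is_derive_zpty (F : 'rV[R]_4 -> R) x y D :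
  is_derive (zpt x y) (ee 1) F D -> is_derive y (1 : R) (fun t => F (zpt x t)) D.
Proof.
move=> dF; have -> : (fun t => F (zpt x t)) = fun t => F (zpt x 0 + t *: ee 1).
  by apply/funext => t; rewrite -zpt_liney add0r.
by apply: is_derive_line; rewrite -zpt_liney add0r.
Qed.

Lemma is_derive_isometry p i a : U p ->
  is_derive p (ee i) (fun q => h q 0 a) (jac h p i a).
Proof.
move=> Up; have := isometry_differentiable hisom Up.
move=> /(diff_derivable (v := ee i))/derivableP/is_derive_mx/(_ 0 a) D.
by apply: is_derive_eq D _; rewrite [RHS]mxE.
Qed.

(** The zero section is preserved. *)
Lemma jac_base_fiber x y (i a : 'I_4) : 0 < y -> (i < 2)%N -> (2 <= a)%N ->
  J x y i a = 0.
Proof.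
move=> y0 i2 a2.
have h0 x' y' : 0 < y' -> h (zpt x' y') 0 a = 0.
  move=> y'0; rewrite isometry_zpt// mxE.
  by case: a a2 => [[|[|[|[|?]]]] ?].
have const0 (F : R -> R) t D : is_derive t (1 : R) F D ->
    (\forall s \near t, (cst 0 : R -> R) s = F s) -> D = 0.
  move=> [_ <-] near0.
  by have [_] := near_eq_is_derive near0 (is_derive_cst (0 : R) t (1 : R)).
have Uz := HxC_zpt x y0.
have [->|->] : i = 0 \/ i = 1.
  by case: i i2 => [[|[|?]] ?] //; [left|right]; apply: val_inj.
- apply: (const0 _ _ _ (is_derive_zptx (is_derive_isometry 0 a Uz))).
  by near=> t; rewrite h0.
- apply: (const0 _ _ _ (is_derive_zpty (is_derive_isometry 1 a Uz))).
  by near=> t; rewrite h0//; near: t; exact: lt_nbhsr.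
Unshelve. all: by end_near. Qed.

(** Fibers are mapped to fibers. *)
Lemma jac_fiber_base x y (i a : 'I_4) : 0 < y -> (2 <= i)%N -> (a < 2)%N ->
  J x y i a = 0.
Proof.
move=> y0 i2 a2; have Uz := HxC_zpt x y0.
have D : is_derive (0 : R) (1 : R) (fun t : R => h (zpt x y + t *: ee i) 0 a)
    (J x y i a).
  apply: (is_derive_line (f := fun q => h q 0 a)).
  by rewrite scale0r addr0; exact: is_derive_isometry.
have cst_eq : (fun t : R => h (zpt x y + t *: ee i) 0 a) = cst (p1 x y) \/
    (fun t : R => h (zpt x y + t *: ee i) 0 a) = cst (p2 x y).
  have coord (t : R) (j : 'I_4) : (j < 2)%N ->
      (zpt x y + t *: ee i) 0 j = zpt x y 0 j.
    move=> j2; rewrite !mxE /=; case: eqP => [ji|_]; last by rewrite mulr0 addr0.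
    by move: i2; rewrite -ji leqNgt j2.
  have Ut (t : R) : U (zpt x y + t *: ee i).
    by rewrite /HxC /= coord// mxE.
  have ft (t : R) : foot (zpt x y + t *: ee i) = zpt x y.
    by rewrite /foot !coord// -/(foot _) foot_zpt.
  have [->|->] : a = 0 \/ a = 1.
    by case: a a2 {D} => [[|[|?]] ?] //; [left|right]; apply: val_inj.
  - by left; apply/funext => t; rewrite (isometry_base_ray k_gt0 hisom (Ut t))// ft.
  - by right; apply/funext => t; rewrite (isometry_base_ray k_gt0 hisom (Ut t))// ft.
by case: cst_eq D => -> [_ <-]; rewrite derive_cst.
Qed.

Lemma djac_entryE i p j m : U p -> djac h i p j m =
  \sum_n conn k i p j n * jac h p n m
  - \sum_n jac h p j n * \sum_a jac h p i a * conn k a (h p) n m.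
Proof.
move=> Up.
have := djacE (@open_HxC R) (isometry_stable hisom) (isometry_Ck hisom 3)
  (fun q Uq i j => differentiable_mx_of i j (@regular_metric R k) Uq)
  (@conn_torsion_free R k) (conn_metric k_gt0) (metric_mx_sym k)
  (metric_mx_unit k_gt0) (jac_isometry hisom) i Up.
move=> /matrixP/(_ j m) ->.
have BE (A B : 'M[R]_4) : (A - B) j m = A j m - B j m by rewrite !mxE.
rewrite BE; congr (_ - _); rewrite [LHS]mxE//.
apply: eq_bigr => n _; rewrite /pullconn summxE; congr (_ * _).
by apply: eq_bigr => a _; rewrite scalemxE.
Qed.

Lemma coords_zpt x y : coords (zpt x y) = nth 0 [:: x; y; 0; 0].
Proof. by rewrite /coords !mxE. Qed.

Lemma conn0_zpt x y (j m : 'I_4) : 0 < y -> conn k 0 (zpt x y) j m =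
  nth 0 (nth [::] [:: [:: 0; y^-1; 0; 0]; [:: - y^-1; 0; 0; 0];
    [:: 0; 0; 0; - (3 / 2 / y)]; [:: 0; 0; 3 / 2 / y; 0]] j) m.
Proof.
move=> y0; have n1 : y != 0 by rewrite gt_eqF.
rewrite mxE /ev coords_zpt.
by case: j => [[|[|[|[|?]]]] ?] //; case: m => [[|[|[|[|?]]]] ?] //;
  cbn -[GRing.natmul]; rewrite /= ?(mulr0, addr0); field.
Qed.

Lemma conn1_zpt x y (j m : 'I_4) : 0 < y -> conn k 1 (zpt x y) j m =
  nth 0 (nth [::] [:: [:: - y^-1; 0; 0; 0]; [:: 0; - y^-1; 0; 0];
    [:: 0; 0; 3 / 2 / y; 0]; [:: 0; 0; 0; 3 / 2 / y]] j) m.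
Proof.
move=> y0; have n1 : y != 0 by rewrite gt_eqF.
rewrite mxE /ev coords_zpt.
by case: j => [[|[|[|[|?]]]] ?] //; case: m => [[|[|[|[|?]]]] ?] //;
  cbn -[GRing.natmul]; rewrite /= ?(mulr0, addr0); field.
Qed.

Lemma metric_zpt x y (j m : 'I_4) : 0 < y -> mx_of (metric k) (zpt x y) j m =
  nth 0 (nth [::] [:: [:: (y ^+ 2)^-1; 0; 0; 0]; [:: 0; (y ^+ 2)^-1; 0; 0];
    [:: 0; 0; - (4 / 3 * k * y ^+ 3); 0];
    [:: 0; 0; 0; - (4 / 3 * k * y ^+ 3)]] j) m.
Proof.
move=> y0; have n1 : y != 0 by rewrite gt_eqF.
rewrite mxE /ev coords_zpt.
by case: j => [[|[|[|[|?]]]] ?] //; case: m => [[|[|[|[|?]]]] ?] //;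
  cbn -[GRing.natmul]; rewrite /= ?(mulr0, addr0); field.
Qed.

Section Entries.
Variables (x y : R).
Hypothesis y0 : 0 < y.

Lemma jac0 :
  ((J x y 0 2 = 0) * (J x y 0 3 = 0) * (J x y 1 2 = 0) * (J x y 1 3 = 0) *
   (J x y 2 0 = 0) * (J x y 3 0 = 0) * (J x y 2 1 = 0) * (J x y 3 1 = 0))%type.
Proof. by do !split; first [exact: jac_base_fiber | exact: jac_fiber_base]. Qed.

Let y_neq0 : y != 0. Proof. by rewrite gt_eqF. Qed.

Let p2_neq0 : p2 x y != 0. Proof. by rewrite gt_eqF// p2_gt0. Qed.

Ltac expand_djac :=
  have p2y := p2_gt0 x y0;
  rewrite (djac_entryE _ _ _ (HxC_zpt x y0)) isometry_zpt// !sum_ord4 -/(J x y) ?jac0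
    !conn0_zpt// !conn1_zpt//=; rewrite ?(mul0r, mulr0, addr0, add0r).

(** The entries of [djacE] that involve second derivatives of [Im phi] and,
    further down, derivatives of the linear map [L(z)]. *)
Lemma djac_b_x : djac h 0 (zpt x y) 0 1 =
  J x y 1 1 / y - (J x y 0 0 ^+ 2 - J x y 0 1 ^+ 2) / p2 x y.
Proof. by expand_djac; field; rewrite ?y_neq0 ?p2_neq0. Qed.

Lemma djac_b_y : djac h 1 (zpt x y) 0 1 = - (J x y 0 1 / y)
  - (J x y 0 0 * J x y 1 0 - J x y 0 1 * J x y 1 1) / p2 x y.
Proof. by expand_djac; field; rewrite ?y_neq0 ?p2_neq0. Qed.

Lemma djac_d_x : djac h 0 (zpt x y) 1 1 = - (J x y 0 1 / y)
  - (J x y 0 0 * J x y 1 0 - J x y 0 1 * J x y 1 1) / p2 x y.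
Proof. by expand_djac; field; rewrite ?y_neq0 ?p2_neq0. Qed.

Lemma djac_d_y : djac h 1 (zpt x y) 1 1 = - (J x y 1 1 / y)
  - (J x y 1 0 ^+ 2 - J x y 1 1 ^+ 2) / p2 x y.
Proof. by expand_djac; field; rewrite ?y_neq0 ?p2_neq0. Qed.

Lemma djac_c1_x : djac h 0 (zpt x y) 2 2 = - (3 / 2 / y * J x y 3 2)
  - 3 / 2 / p2 x y * (J x y 0 1 * J x y 2 2 + J x y 0 0 * J x y 2 3).
Proof. by expand_djac; field; rewrite ?y_neq0 ?p2_neq0. Qed.

Lemma djac_c2_x : djac h 0 (zpt x y) 2 3 = - (3 / 2 / y * J x y 3 3)
  - 3 / 2 / p2 x y * (J x y 0 1 * J x y 2 3 - J x y 0 0 * J x y 2 2).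
Proof. by expand_djac; field; rewrite ?y_neq0 ?p2_neq0. Qed.

Lemma djac_c1_y : djac h 1 (zpt x y) 2 2 = 3 / 2 / y * J x y 2 2
  - 3 / 2 / p2 x y * (J x y 1 1 * J x y 2 2 + J x y 1 0 * J x y 2 3).
Proof. by expand_djac; field; rewrite ?y_neq0 ?p2_neq0. Qed.

Lemma djac_c2_y : djac h 1 (zpt x y) 2 3 = 3 / 2 / y * J x y 2 3
  - 3 / 2 / p2 x y * (J x y 1 1 * J x y 2 3 - J x y 1 0 * J x y 2 2).
Proof. by expand_djac; field; rewrite ?y_neq0 ?p2_neq0. Qed.

Lemma jac_isometry_entry i j :
  \sum_n (\sum_m J x y i m * mx_of (metric k) (zpt (p1 x y) (p2 x y)) m n)
    * J x y j n = mx_of (metric k) (zpt x y) i j.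
Proof.
have Uz := HxC_zpt x y0; rewrite -(jac_isometry hisom Uz) isometry_zpt//.
rewrite [RHS]mxE; apply: eq_bigr => n _.
by rewrite [_^T _ _]mxE [(_ *m _) i n]mxE.
Qed.

Ltac expand_isometry i j :=
  have p2y := p2_gt0 x y0; have := jac_isometry_entry i j;
  rewrite !sum_ord4 ?jac0 !metric_zpt//=; rewrite ?(mul0r, mulr0, addr0, add0r).

Lemma jac_conf_xx : J x y 0 0 ^+ 2 + J x y 0 1 ^+ 2 = (p2 x y / y) ^+ 2.
Proof.
expand_isometry (0 : 'I_4) (0 : 'I_4) => e.
transitivity (p2 x y ^+ 2 * (J x y 0 0 * (p2 x y ^+ 2)^-1 * J x y 0 0
  + J x y 0 1 * (p2 x y ^+ 2)^-1 * J x y 0 1)); first by field.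
by rewrite e; field; rewrite y_neq0.
Qed.

Lemma jac_conf_xy : J x y 0 0 * J x y 1 0 + J x y 0 1 * J x y 1 1 = 0.
Proof.
expand_isometry (0 : 'I_4) (1 : 'I_4) => e.
transitivity (p2 x y ^+ 2 * (J x y 0 0 * (p2 x y ^+ 2)^-1 * J x y 1 0
  + J x y 0 1 * (p2 x y ^+ 2)^-1 * J x y 1 1)); first by field.
by rewrite e mulr0.
Qed.

Lemma jac_conf_yy : J x y 1 0 ^+ 2 + J x y 1 1 ^+ 2 = (p2 x y / y) ^+ 2.
Proof.
expand_isometry (1 : 'I_4) (1 : 'I_4) => e.
transitivity (p2 x y ^+ 2 * (J x y 1 0 * (p2 x y ^+ 2)^-1 * J x y 1 0
  + J x y 1 1 * (p2 x y ^+ 2)^-1 * J x y 1 1)); first by field.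
by rewrite e; field; rewrite y_neq0.
Qed.

Lemma jac_fiber_norm :
  J x y 2 2 ^+ 2 + J x y 2 3 ^+ 2 = (y / p2 x y) ^+ 3.
Proof.
expand_isometry (2 : 'I_4) (2 : 'I_4) => e.
transitivity ((J x y 2 2 * - (4 / 3 * k * p2 x y ^+ 3) * J x y 2 2
  + J x y 2 3 * - (4 / 3 * k * p2 x y ^+ 3) * J x y 2 3)
  / - (4 / 3 * k * p2 x y ^+ 3)); first by field; rewrite p2_neq0 k_neq0.
by rewrite e; field; rewrite p2_neq0 k_neq0.
Qed.

End Entries.

Lemma curv_antisym i l p j m : curv (conn k) i l p j m = - curv (conn k) l i p j m.
Proof.
rewrite /curv; set a := _ l p; set b := _ i p; set c := _ *m _; set e := _ *m _.
by rewrite !mxE; ring.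
Qed.

Lemma curv_zpt x y (j m : 'I_4) : 0 < y -> (2 <= j)%N -> (2 <= m)%N ->
  curv (conn k) 0 1 (zpt x y) j m =
  3 / 2 / y ^+ 2 * ((j == 2%N :> nat)%:R * (m == 3%N :> nat)%:R
                    - (j == 3%N :> nat)%:R * (m == 2%N :> nat)%:R).
Proof.
move=> y0 j2 m2; have n1 : y != 0 by rewrite gt_eqF.
rewrite (curv_conn k_gt0 _ _ _ _ (HxC_zpt x y0)) coords_zpt.
by apply: curvature_zero_sectionE.
Qed.

(** Along the zero section, the curvature operator of the horizontal plane acts
    on the fiber as a multiple of the rotation by a right angle, and this
    multiple changes sign with the orientation of the plane.  The second row of
    [L(z)] is thus the image of the first one by the rotation, up to the sign
    [s] of the determinant of the differential of [phi]. *)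
Lemma jac_fiber_orientation x y : 0 < y ->
  let s := (J x y 0 0 * J x y 1 1 - J x y 0 1 * J x y 1 0) / (p2 x y / y) ^+ 2 in
  J x y 3 2 = - s * J x y 2 3 /\ J x y 3 3 = s * J x y 2 2.
Proof.
move=> y0 s; have Uz := HxC_zpt x y0.
have p2y := p2_gt0 x y0.
have y_neq0 : y != 0 by rewrite gt_eqF.
have p2_neq0 : p2 x y != 0 by rewrite gt_eqF.
have := curv_equivariant (@open_HxC R) (isometry_stable hisom)
  (isometry_Ck hisom 3)
  (fun q Uq i j => differentiable_mx_of i j (@regular_metric R k) Uq)
  (fun q Uq i j m => differentiable_mx_of j m (@regular_christoffel R k k_gt0 i) Uq)
  (@conn_torsion_free R k) (conn_metric k_gt0) (metric_mx_sym k)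
  (metric_mx_unit k_gt0) (jac_isometry hisom) 0 1 Uz.
rewrite isometry_zpt// -/(J x y) => /matrixP E.
have e m : \sum_n curv (conn k) 0 1 (zpt x y) 2 n * J x y n m =
    \sum_n J x y 2 n * \sum_a \sum_b J x y 0 a * J x y 1 b *
      curv (conn k) a b (zpt (p1 x y) (p2 x y)) n m.
  have := E 2 m; rewrite [LHS]mxE [RHS]mxE => ->; apply: eq_bigr => n _.
  congr (_ * _); rewrite summxE; apply: eq_bigr => a _; rewrite summxE.
  by apply: eq_bigr => b _; rewrite scalemxE.
have diag0 a n m : curv (conn k) a a (zpt (p1 x y) (p2 x y)) n m = 0.
  by have := curv_antisym a a (zpt (p1 x y) (p2 x y)) n m; lra.
have swap n m := curv_antisym 1 0 (zpt (p1 x y) (p2 x y)) n m.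
have sE : J x y 0 0 * J x y 1 1 - J x y 0 1 * J x y 1 0
   = s * (p2 x y / y) ^+ 2.
  by rewrite /s divfK// expf_neq0// mulf_neq0// invr_eq0.
have val r q : 0 < q ->
    [/\ curv (conn k) 0 1 (zpt r q) 2 2 = 0,
        curv (conn k) 0 1 (zpt r q) 2 3 = 3 / 2 / q ^+ 2,
        curv (conn k) 0 1 (zpt r q) 3 2 = - (3 / 2 / q ^+ 2)
      & curv (conn k) 0 1 (zpt r q) 3 3 = 0].
  by move=> q0; split; rewrite curv_zpt//=; ring.
have [v22 v23 v32 v33] := val x y y0.
have [w22 w23 w32 w33] := val (p1 x y) (p2 x y) p2y.
split.
- have := e 2; rewrite !sum_ord4 !jac0// !(mul0r, mulr0, addr0, add0r).
  rewrite v22 v23 (diag0 0 2 2) (diag0 1 2 2) (swap 2 2) w22.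
  rewrite (diag0 0 3 2) (diag0 1 3 2) (swap 3 2) w32 => H.
  transitivity (2 / 3 * y ^+ 2 * (0 * J x y 2 2 + 3 / 2 / y ^+ 2 * J x y 3 2)).
    by field.
  rewrite H.
  transitivity (- (y / p2 x y) ^+ 2 * J x y 2 3
      * (J x y 0 0 * J x y 1 1 - J x y 0 1 * J x y 1 0)); first by field.
  by rewrite sE; field; rewrite y_neq0 p2_neq0.
- have := e 3; rewrite !sum_ord4 !jac0// !(mul0r, mulr0, addr0, add0r).
  rewrite v22 v23 (diag0 0 2 3) (diag0 1 2 3) (swap 2 3) w23.
  rewrite (diag0 0 3 3) (diag0 1 3 3) (swap 3 3) w33 => H.
  transitivity (2 / 3 * y ^+ 2 * (0 * J x y 2 3 + 3 / 2 / y ^+ 2 * J x y 3 3)).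
    by field.
  rewrite H.
  transitivity ((y / p2 x y) ^+ 2 * J x y 2 2
      * (J x y 0 0 * J x y 1 1 - J x y 0 1 * J x y 1 0)); first by field.
  by rewrite sE; field; rewrite y_neq0 p2_neq0.
Qed.

Lemma is_derive_jac_entry l p i a : U p ->
  is_derive p (ee l) (fun q => jac h q i a) (djac h l p i a).
Proof.
move=> Up; have := is_derive_jac (isometry_Ck hisom 3) l Up.
by move=> /is_derive_mx; exact.
Qed.

Theorem zero_section_isometry : exists al be g dl e t1 t2 : R,
  [/\ al * dl - be * g = 1, e = 1 \/ e = -1, t1 ^+ 2 + t2 ^+ 2 = 1 &
   forall x y, 0 < y ->
    let X := e * x in let m := g * X + dl in let N := m ^+ 2 + (g * y) ^+ 2 in
    let r := m ^+ 3 - 3 * m * (g * y) ^+ 2 in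
    let s := 3 * m ^+ 2 * (g * y) - (g * y) ^+ 3 in
    [/\ 0 < N,
        h (zpt x y) 0 0 = ((al * X + be) * m + al * g * y ^+ 2) / N,
        h (zpt x y) 0 1 = y / N,
        jac h (zpt x y) 2 2 = t1 * r - t2 * s
          /\ jac h (zpt x y) 2 3 = t1 * s + t2 * r
      & jac h (zpt x y) 3 2 = - e * jac h (zpt x y) 2 3
          /\ jac h (zpt x y) 3 3 = e * jac h (zpt x y) 2 2]].
Proof.
have dJx x y (y0 : 0 < y) i a := is_derive_zptx
  (is_derive_jac_entry 0 i a (HxC_zpt x y0)).
have dJy x y (y0 : 0 < y) i a := is_derive_zpty
  (is_derive_jac_entry 1 i a (HxC_zpt x y0)).
have dhx x y (y0 : 0 < y) a := is_derive_zptx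
  (is_derive_isometry 0 a (HxC_zpt x y0)).
have dhy x y (y0 : 0 < y) a := is_derive_zpty
  (is_derive_isometry 1 a (HxC_zpt x y0)).
have [al [be [g [dl [e [det1 e_pm base]]]]]] := @half_plane_isometry R p1 p2
  (fun x y => J x y 0 0) (fun x y => J x y 0 1)
  (fun x y => J x y 1 0) (fun x y => J x y 1 1) p2_gt0
  (fun x y pos => dhx x y pos 0) (fun x y pos => dhx x y pos 1)
  (fun x y pos => dhy x y pos 0) (fun x y pos => dhy x y pos 1)
  jac_conf_xx jac_conf_xy jac_conf_yy
  (fun x y pos => @ex_derive _ _ _ _ _ _ _ (dJx x y pos 0 0))
  (fun x y pos => @ex_derive _ _ _ _ _ _ _ (dJy x y pos 0 0))
  (fun x y pos => @ex_derive _ _ _ _ _ _ _ (dJx x y pos 1 0))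
  (fun x y pos => @ex_derive _ _ _ _ _ _ _ (dJy x y pos 1 0))
  (fun x y pos => is_derive_eq (dJx x y pos 0 1) (djac_b_x x pos))
  (fun x y pos => is_derive_eq (dJy x y pos 0 1) (djac_b_y x pos))
  (fun x y pos => is_derive_eq (dJx x y pos 1 1) (djac_d_x x pos))
  (fun x y pos => is_derive_eq (dJy x y pos 1 1) (djac_d_y x pos)).
have orient x y : 0 < y ->
    J x y 3 2 = - e * J x y 2 3 /\ J x y 3 3 = e * J x y 2 2.
  move=> y0; have := jac_fiber_orientation x y0; rewrite /=.
  set s := (X in X / _); suff -> : s / (p2 x y / y) ^+ 2 = e by [].
  have n0 : (p2 x y / y) ^+ 2 != 0.
    by rewrite expf_neq0// mulf_neq0// ?invr_eq0 gt_eqF// p2_gt0.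
  apply: (mulIf n0); rewrite divfK// -(jac_conf_yy x y0) /s.
  by have [_ _ _ [-> ->] _] := base x y y0; case: e_pm => ->; ring.
have N_gt0 x y : 0 < y -> 0 < (g * (e * x) + dl) ^+ 2 + (g * y) ^+ 2.
  by move=> y0; have [] := base x y y0.
have p2E x y : 0 < y -> p2 x y = y / ((g * (e * x) + dl) ^+ 2 + (g * y) ^+ 2).
  by move=> y0; have [] := base x y y0.
have bE x y : 0 < y -> J x y 0 1 = - (2 * g * e * (g * (e * x) + dl) * y)
    / ((g * (e * x) + dl) ^+ 2 + (g * y) ^+ 2) ^+ 2.
  by move=> y0; have [_ _ _ _ []] := base x y y0.
have dE x y : 0 < y -> J x y 1 1 = ((g * (e * x) + dl) ^+ 2 - (g * y) ^+ 2)
    / ((g * (e * x) + dl) ^+ 2 + (g * y) ^+ 2) ^+ 2.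
  by move=> y0; have [_ _ _ _ []] := base x y y0.
have acE x y : 0 < y ->
    J x y 0 0 = e * J x y 1 1 /\ J x y 1 0 = - e * J x y 0 1.
  by move=> y0; have [] := base x y y0.
have dx_c1 x y : 0 < y -> is_derive x (1 : R) (fun x => J x y 2 2)
    (3 / 2 / y * e * J x y 2 3
     - 3 / 2 / p2 x y * (J x y 0 1 * J x y 2 2 + e * J x y 1 1 * J x y 2 3)).
  move=> y0; apply: is_derive_eq (dJx x y y0 2 2) _; rewrite djac_c1_x//.
  by have [-> _] := orient x y y0; have [-> _] := acE x y y0; ring.
have dx_c2 x y : 0 < y -> is_derive x (1 : R) (fun x => J x y 2 3)
    (- (3 / 2 / y * e * J x y 2 2)
     - 3 / 2 / p2 x y * (J x y 0 1 * J x y 2 3 - e * J x y 1 1 * J x y 2 2)).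
  move=> y0; apply: is_derive_eq (dJx x y y0 2 3) _; rewrite djac_c2_x//.
  by have [_ ->] := orient x y y0; have [-> _] := acE x y y0; ring.
have dy_c1 x y : 0 < y -> is_derive y (1 : R) (fun y => J x y 2 2)
    (3 / 2 / y * J x y 2 2
     - 3 / 2 / p2 x y * (J x y 1 1 * J x y 2 2 - e * J x y 0 1 * J x y 2 3)).
  move=> y0; apply: is_derive_eq (dJy x y y0 2 2) _; rewrite djac_c1_y//.
  by have [_ ->] := acE x y y0; ring.
have dy_c2 x y : 0 < y -> is_derive y (1 : R) (fun y => J x y 2 3)
    (3 / 2 / y * J x y 2 3
     - 3 / 2 / p2 x y * (J x y 1 1 * J x y 2 3 + e * J x y 0 1 * J x y 2 2)).
  move=> y0; apply: is_derive_eq (dJy x y y0 2 3) _; rewrite djac_c2_y//.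
  by have [_ ->] := acE x y y0; ring.
have norm_c x y : 0 < y -> J x y 2 2 ^+ 2 + J x y 2 3 ^+ 2 =
    ((g * (e * x) + dl) ^+ 2 + (g * y) ^+ 2) ^+ 3.
  move=> y0; rewrite jac_fiber_norm// p2E//; congr (_ ^+ 3).
  have n1 : y != 0 by rewrite gt_eqF.
  by rewrite invf_div mulrCA mulfV ?mulr1.
have [t1 [t2 [t12 fib]]] := @fiber_factor R g dl e
  p2 (fun x y => J x y 0 1) (fun x y => J x y 1 1)
  (fun x y => J x y 2 2) (fun x y => J x y 2 3) e_pm
  N_gt0 p2E bE dE dx_c1 dx_c2 dy_c1 dy_c2 norm_c.
exists al, be, g, dl, e, t1, t2; split=> // x y y0.
have [N0 p1E' p2E' _ _] := base x y y0.
by split; [| | |exact: fib|exact: orient].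
Qed.

End ZeroSection.

(** * The isometry as a composition of the standard ones *)

Section Coordinates.
Variable R : realType.
Implicit Types (p : 'rV[R]_4).

Lemma polar (t1 t2 : R) : t1 ^+ 2 + t2 ^+ 2 = 1 ->
  exists theta : R, cos theta = t1 /\ sin theta = t2.
Proof.
move=> t12; have t1_itv : -1 <= t1 <= 1.
  by apply/andP; split; have := sqr_ge0 t2; nra.
have ct : cos (acos t1) = t1 by apply: acosK; rewrite in_itv.
have st : sin (acos t1) = `|t2|.
  by rewrite sin_acos// -sqrtr_sqr; congr Num.sqrt; rewrite -t12 addrC addKr.
have [t2_ge0|t2_lt0] := leP 0 t2.
  by exists (acos t1); rewrite ct st ger0_norm.
by exists (- acos t1); rewrite cosN sinN ct st ltr0_norm// opprK.
Qed.

Lemma rV4P (p q : 'rV[R]_4) : p 0 0 = q 0 0 -> p 0 1 = q 0 1 ->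
  p 0 2 = q 0 2 -> p 0 3 = q 0 3 -> p = q.
Proof.
move=> e0 e1 e2 e3; apply/rowP => a.
have [->|[->|[->|->]]] // : a = 0 \/ a = 1 \/ a = 2 \/ a = 3.
by case: a => [[|[|[|[|?]]]] ?] //;
  [left|right; left|do 2!right; left|do 3!right]; apply: val_inj.
Qed.

Definition mx22 (al be g dl : R) : 'M[R]_2 :=
  \matrix_(i, j) nth 0 (nth [::] [:: [:: al; be]; [:: g; dl]] i) j.

Lemma det_mx22 al be g dl : \det (mx22 al be g dl) = al * dl - be * g.
Proof.
rewrite (expand_det_row _ 0) !big_ord_recr big_ord0 /= /cofactor !det_mx11.
by rewrite !mxE /=; ring.
Qed.

(** [m] and [N] are the real part and the squared modulus of [j = g z + dl],
    and [r + i s] is [j^3]. *)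
Lemma SL2_S1_coords (al be g dl theta : R) p :
  let P := mx22 al be g dl in let q := SL2_act P (S1_act theta p) in
  let m := g * p 0 0 + dl in let N := m ^+ 2 + (g * p 0 1) ^+ 2 in
  let r := m ^+ 3 - 3 * m * (g * p 0 1) ^+ 2 in
  let s := 3 * m ^+ 2 * (g * p 0 1) - (g * p 0 1) ^+ 3 in
  let c1 := cos theta * r - sin theta * s in
  let c2 := cos theta * s + sin theta * r in
  [/\ q 0 0 = ((al * p 0 0 + be) * m + al * g * p 0 1 ^+ 2) / N,
      q 0 1 = (al * dl - be * g) * p 0 1 / N,
      q 0 2 = c1 * p 0 2 - c2 * p 0 3 & q 0 3 = c1 * p 0 3 + c2 * p 0 2].
Proof.
move=> P q m N r s c1 c2.
have q0 : S1_act theta p 0 0 = p 0 0 by rewrite mxE.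
have q1 : S1_act theta p 0 1 = p 0 1 by rewrite mxE.
have q2 : S1_act theta p 0 2 = cos theta * p 0 2 - sin theta * p 0 3.
  by rewrite mxE.
have q3 : S1_act theta p 0 3 = cos theta * p 0 3 + sin theta * p 0 2.
  by rewrite mxE.
have [P00 P01] : P 0 0 = al /\ P 0 1 = be by rewrite !mxE.
have [P10 P11] : P 1 0 = g /\ P 1 1 = dl by rewrite !mxE.
have mE : g * p 0 0 - 0 * p 0 1 + dl = m by rewrite /m; ring.
have gE : g * p 0 1 + 0 * p 0 0 + 0 = g * p 0 1 by ring.
split; rewrite /q /SL2_act mxE /zcoord /wcoord q0 q1 q2 q3 P00 P01 P10 P11 /=.
- rewrite mE gE -/N; ring.
- by rewrite mE gE -/N; move: (N^-1) => N'; rewrite /m; ring.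
- rewrite mE gE /c1 /c2 /r /s; ring.
- rewrite mE gE /c1 /c2 /r /s; ring.
Qed.

Lemma h1h2_coords p : @h1 R (@h2 R p) = mkpoint (- p 0 0) (p 0 1) (p 0 2) (- p 0 3).
Proof. by apply: rV4P; rewrite !mxE /= ?opprK mxE. Qed.

End Coordinates.

Theorem corollaryC (R : realType) (k : R) (hk : 0 < k)
    (h : 'rV[R]_4 -> 'rV[R]_4)
    (hisom : metric_isometry (gmetric (fun t : R => - k * t)) (@HxC R) h) :
  exists (P : 'M[R]_2) (theta : R),
    \det P = 1 /\
    [\/ {in @HxC R, h =1 SL2_act P \o S1_act theta},
        {in @HxC R, h =1 SL2_act P \o S1_act theta \o @h1 R},
        {in @HxC R, h =1 SL2_act P \o S1_act theta \o @h2 R} |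
        {in @HxC R, h =1 SL2_act P \o S1_act theta \o @h1 R \o @h2 R}].
Proof.
have [al [be [g [dl [e [t1 [t2 [det1 e_pm t12 base]]]]]]]] :=
  zero_section_isometry hk hisom.
have [theta [ct st]] := polar t12.
exists (mx22 al be g dl), theta; split; first by rewrite det_mx22.
have key p : HxC p -> h p =
    SL2_act (mx22 al be g dl) (S1_act theta
      (mkpoint (e * p 0 0) (p 0 1) (p 0 2) (e * p 0 3))).
  move=> Up; have y0 : 0 < p 0 1 := Up.
  have [N0 b0 b1 [J22 J23] [J32 J33]] := base (p 0 0) (p 0 1) y0.
  set q := mkpoint _ _ _ _.
  have [c0 c1 c2 c3] : [/\ q 0 0 = e * p 0 0, q 0 1 = p 0 1, q 0 2 = p 0 2
      & q 0 3 = e * p 0 3] by split; rewrite mxE.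
  have [] := SL2_S1_coords al be g dl theta q.
  rewrite c0 c1 c2 c3 ct st => q0 q1 q2 q3.
  have fib (a : 'I_4) : (2 <= a)%N -> h p 0 a =
      p 0 2 * jac h (zpt (p 0 0) (p 0 1)) 2 a
      + p 0 3 * jac h (zpt (p 0 0) (p 0 1)) 3 a.
    move=> a2; rewrite (isometry_fiber_ray hk hisom Up a2) mxE sum_ord4.
    by rewrite !mxE /= !mul0r !add0r.
  apply: rV4P.
  - by rewrite q0 (isometry_base_ray hk hisom Up)// -/(zpt _ _) b0.
  - by rewrite q1 (isometry_base_ray hk hisom Up)// -/(zpt _ _) b1 det1 mul1r.
  - by rewrite q2 fib// J32 J22 J23; ring.
  - by rewrite q3 fib// J33 J22 J23; case: e_pm => ->; ring.
case: e_pm key => -> key.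
  (* For [e = 1] the point [key] acts on is [p], for [e = -1] it is
     [h1 (h2 p)]. *)
  apply: Or41 => p; rewrite inE => Up; rewrite key//=; congr (SL2_act _ (S1_act _ _)).
  by apply: rV4P; rewrite mxE /= ?mul1r.
apply: Or44 => p; rewrite inE => Up; rewrite key//= h1h2_coords.
by rewrite !mulN1r.
Qed.
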